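(* Let $k$ be an infinite field with $\mathrm{char}(k)\neq 2,3$ and $V_2$ a $2$-dimensional $k$-vector space with basis $\{e_1,e_2\}$. The linear map $\det^{S^3}:V_2^{\otimes 20}\to k$ is the unique (up to a constant) nontrivial linear map on $V_2^{\otimes 20}$ with the property that $\det^{S^3}(\otimes_{1\le i<j<k\le 6}(v_{i,j,k}))=0$ whenever there exist $1\le x<y<z<t\le 6$ with $v_{x,y,z}=v_{x,y,t}=v_{x,z,t}=v_{y,z,t}$. In particular, $\det^{S^3}$ induces a unique (up to a constant) nontrivial linear map $\Lambda^{S^3}_{V_2}[6]\to k$.
   Context: Tensors in $V_2^{\otimes 20}$ have factors indexed by the triples $(i,j,k)$, $1\le i<j<k\le 6$; simple tensors are written $\otimes_{1\le i<j<k\le 6}(v_{i,j,k})$. $\mathcal{E}^{S^3}_{V_2}[6]$ is the subspace spanned by simple tensors for which there exist $1\le x<y<z<t\le 6$ with $v_{x,y,z}=v_{x,y,t}=v_{x,z,t}=v_{y,z,t}$, and $\Lambda^{S^3}_{V_2}[6]=V_2^{\otimes 20}/\mathcal{E}^{S^3}_{V_2}[6]$. $K_6^3$ is the complete $3$-uniform hypergraph on $\{1,\dots,6\}$ (hyperedges: all $20$ three-element subsets). A homogeneous $2$-partition is an ordered pair $(\mathcal{H}_1,\mathcal{H}_2)$ of disjoint sets of hyperedges with union all hyperedges and $|\mathcal{H}_1|=|\mathcal{H}_2|=10$; $\mathcal{P}_2^h(K_6^3)$ is the set of these. For $\mathcal{P}\in\mathcal{P}_2^h(K_6^3)$ and $1\le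 x<y<z<t\le6$, $\mathrm{Pair}(\mathcal{P},(x,y,z,t))$ is the set of homogeneous $2$-partitions coinciding with $\mathcal{P}$ except possibly on the hyperedges $\{x,y,z\},\{x,y,t\},\{x,z,t\},\{y,z,t\}$. Let $\varepsilon^{S^3}:\mathcal{P}_2^h(K_6^3)\to\{-4,-1,0,1\}$ be the unique map such that $\sum_{\mathcal{K}\in\mathrm{Pair}(\mathcal{P},(x,y,z,t))}\varepsilon^{S^3}(\mathcal{K})=0$ for all $\mathcal{P}$ and all $x<y<z<t$, and $\varepsilon^{S^3}(\mathcal{P}^{(1)})=1$ for $\mathcal{P}^{(1)}$ with $\mathcal{H}_1=\{\{1,2,3\},\{1,2,4\},\{1,3,4\},\{1,2,5\},\{3,4,5\},\{1,5,6\},\{2,4,6\},\{2,5,6\},\{3,4,6\},\{4,5,6\}\}$. A homogeneous $2$-partition $(\mathcal{H}_1,\mathcal{H}_2)$ is called nontrivial if for no $i\in\{1,2\}$ does $\mathcal{H}_i$ contain any of the following configurations (letters denoting distinct elements of $\{1,\dots,6\}$): (a) $\{x,y,z\},\{x,y,t\},\{x,z,t\},\{y,z,t\}$; (b) $\{x,y,z\},\{x,y,t\},\{x,z,t\},\{y,z,u\},\{y,t,u\},\{z,t,u\}$; (c) $\{x,y,u\},\{x,y,v\},\{y,z,u\},\{x,z,u\},\{x,t,v\},\{y,t,v\},\{y,z,t\},\{x,z,t\}$; (d) $\{x,y,z\},\{x,y,t\},\{x,z,t\},\{x,y,u\},\{y,t,u\},\{x,y,v\},\{x,u,v\},\{y,z,v\},\{z,t,v\},\{t,u,v\}$;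 $\mathcal{P}_2^{h,nt}(K_6^3)$ denotes the set of nontrivial ones. For $v_{i,j,k}=\alpha_{i,j,k}e_1+\beta_{i,j,k}e_2$, set $M_{(\mathcal{H}_1,\mathcal{H}_2)}((v_{i,j,k}))=\prod_{\{a,b,c\}\in\mathcal{H}_1}\alpha_{a,b,c}\prod_{\{a,b,c\}\in\mathcal{H}_2}\beta_{a,b,c}$, and let $\det^{S^3}:V_2^{\otimes 20}\to k$ be the linear map with $\det^{S^3}(\otimes_{1\le i<j<k\le 6}(v_{i,j,k}))=\sum_{(\mathcal{H}_1,\mathcal{H}_2)\in\mathcal{P}_2^{h,nt}(K_6^3)}\varepsilon^{S^3}(\mathcal{H}_1,\mathcal{H}_2)M_{(\mathcal{H}_1,\mathcal{H}_2)}((v_{i,j,k}))$. *)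

(* Defs.v *)
From HB Require Import structures.
From mathcomp Require Import all_boot all_order all_algebra.
From mathcomp Require classical_sets cardinality.

Set Implicit Arguments.
Unset Strict Implicit.
Unset Printing Implicit Defensive.

Import Order.TTheory GRing.Theory Num.Theory.
Local Open Scope ring_scope.

(** * Tensor powers, spans and quotients *)

Definition update (I : finType) (V : Type) (v : {ffun I -> V}) (i : I) (x : V) :
  {ffun I -> V} := [ffun j => if j == i then x else v j].

Definition multilinear (k : fieldType) (I : finType) (V W : lmodType k)
    (f : {ffun I -> V} -> W) : Prop :=
  forall (i : I) (v : {ffun I -> V}) (a : k) (x y : V),
    f (update v i (a *: x + y)) = a *: f (update v i x) + f (update v i y).

(* [T], with [tens v] in the role of the simple tensor of the family [v], is
   the tensor product of copies of [V] indexed by [I]: [tens] is the universal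
   multilinear map.  See [tensor_power_exists] below. *)
Definition is_tensor_power (k : fieldType) (I : finType) (V T : lmodType k)
    (tens : {ffun I -> V} -> T) : Prop :=
  multilinear tens /\
  forall (W : lmodType k) (f : {ffun I -> V} -> W), multilinear f ->
    exists g : {linear T -> W},
      (forall v, g (tens v) = f v) /\
      (forall h : {linear T -> W}, (forall v, h (tens v) = f v) -> h =1 g).

Lemma update_id (I : finType) (V : Type) (v : {ffun I -> V}) (i : I) :
  update v i (v i) = v.
Proof. by apply/ffunP => j; rewrite ffunE; case: eqP => // ->. Qed.

Lemma multilinear_sum (k : fieldType) (I : finType) (V W : lmodType k)
    (f : {ffun I -> V} -> W) (v : {ffun I -> V}) (i : I) (n : nat)
    (a : 'I_n -> k) (x : 'I_n -> V) : multilinear f ->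
  f (update v i (\sum_j a j *: x j)) = \sum_j a j *: f (update v i (x j)).
Proof.
move=> fL.
have f0 : f (update v i 0) = 0.
  by have := fL i v (-1) 0 0; rewrite scaler0 addr0 scaleN1r addNr.
by elim/big_rec2: _ => // j y z _ <-; rewrite fL.
Qed.

Lemma multilinear_ext (k : fieldType) (I : finType) (V : vectType k) (n : nat)
    (e : n.-tuple V) (W : lmodType k) (f g : {ffun I -> V} -> W) :
  basis_of fullv e -> multilinear f -> multilinear g ->
  (forall c : {ffun I -> 'I_n},
     f [ffun i => tnth e (c i)] = g [ffun i => tnth e (c i)]) ->
  f =1 g.
Proof.
move=> eB fL gL fg v.
have [m] := ubnP #|[set i | v i \notin (e : seq V)]|.
elim: m v => // m IH v; rewrite ltnS => le_m.
have [all_e|] := boolP [forall i, v i \in (e : seq V)].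
  have ex_c i : exists j, v i = tnth e j by apply/tnthP; apply: (forallP all_e).
  have [c vc] := fin_all_exists ex_c.
  have -> : v = [ffun i => tnth e ([ffun i => c i] i)].
    by apply/ffunP => i; rewrite !ffunE.
  exact: fg.
case/forallPn => i vi.
have -> : v = update v i (\sum_j coord e j (v i) *: e`_j).
  by rewrite -(coord_basis eB (memvf _)) update_id.
rewrite !multilinear_sum //; apply: eq_bigr => j _; congr (_ *: _).
apply: IH; apply: leq_trans le_m; apply: proper_card; apply/properP; split.
  apply/subsetP => l; rewrite !inE ffunE; case: eqP => // _.
  by rewrite mem_nth // size_tuple.
by exists i; rewrite !inE // ffunE eqxx mem_nth ?size_tuple.
Qed.

Lemma prod_coord_multilinear (k : fieldType) (I : finType) (V : vectType k)
    (n : nat) (e : n.-tuple V) (c : I -> 'I_n) :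
  multilinear (fun v : {ffun I -> V} => \prod_i coord e (c i) (v i) : k^o).
Proof.
move=> i v a x y.
have prodE z : \prod_j coord e (c j) (update v i z j) =
    coord e (c i) z * \prod_(j | j != i) coord e (c j) (v j).
  rewrite (bigD1 i) //= ffunE eqxx; congr (_ * _).
  by apply: eq_bigr => j /negPf ji; rewrite ffunE ji.
by rewrite !prodE linearP mulrDl -mulrA.
Qed.

Lemma tensor_power_exists (k : fieldType) (I : finType) (V : vectType k) :
  exists (T : lmodType k) (tens : {ffun I -> V} -> T), is_tensor_power tens.
Proof.
pose n := \dim (fullv : {vspace V}).
pose e : n.-tuple V := vbasis fullv.
have eB : basis_of fullv e by apply: vbasisP.
pose T : lmodType k := {ffun {ffun I -> 'I_n} -> k^o}.
pose tens (v : {ffun I -> V}) : T :=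
  [ffun c : {ffun I -> 'I_n} => \prod_i coord e (c i) (v i)].
have tensL : multilinear tens.
  move=> i v a x y; apply/ffunP => c; rewrite !ffunE.
  exact: (prod_coord_multilinear e c).
have tensB (c d : {ffun I -> 'I_n}) :
    tens [ffun i => tnth e (c i)] d = (c == d)%:R.
  rewrite ffunE.
  under eq_bigr => i _ do
    rewrite ffunE (tnth_nth 0) coord_free ?(basis_free eB) //.
  case: eqP => [-> | cd]; first by rewrite big1 // => i _; rewrite eqxx.
  have [i ci] : exists i, c i != d i.
    apply/existsP; rewrite -negb_forall; apply/negP => /forallP cdE.
    by apply: cd; apply/ffunP => i; apply/eqP.
  by rewrite (bigD1 i) //= [_ == _](negPf ci) mul0r.
exists T, tens; split=> // W f fL.
pose g0 (t : T) : W :=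
  \sum_(c : {ffun I -> 'I_n}) t c *: f [ffun i => tnth e (c i)].
have g0L : linear g0.
  move=> a t u; rewrite /g0 scaler_sumr -big_split /=; apply: eq_bigr => c _.
  by rewrite !ffunE scalerDl scalerA.
pose gM := GRing.isLinear.Build k T W *:%R g0 g0L.
pose g : {linear T -> W} := HB.pack g0 gM.
have gE (t : T) : g t = g0 t by [].
have gB (h : {linear T -> W}) : multilinear (fun v => h (tens v)).
  by move=> i v a x y; rewrite tensL linearP.
exists g; split.
  apply: (multilinear_ext eB) => // c; rewrite gE /g0 (bigD1 c) //= tensB eqxx.
  rewrite scale1r big1 ?addr0 // => d dc.
  by rewrite tensB eq_sym (negPf dc) scale0r.
move=> h hE t; rewrite gE /g0.
have {1}-> : t = \sum_(c : {ffun I -> 'I_n}) t c *: tens [ffun i => tnth e (c i)].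
  apply/ffunP => d; rewrite sum_ffunE (bigD1 d) //= !ffunE -[\prod_i _]/_.
  have := tensB d d; rewrite ffunE eqxx => ->; rewrite [_ *: _]mulr1.
  rewrite big1 ?addr0 // => c cd; rewrite ffunE tensB (negPf cd).
  exact: scaler0.
by rewrite linear_sum; apply: eq_bigr => c _; rewrite linearZ hE.
Qed.

Definition in_span (k : fieldType) (T : lmodType k) (S : T -> Prop) (t : T) :
    Prop :=
  exists (n : nat) (c : 'I_n -> k) (s : 'I_n -> T),
    (forall i, S (s i)) /\ t = \sum_(i < n) c i *: s i.

(* [Q] is the quotient of [T] by the subspace [E], with projection [pi]. *)
Definition is_quotient (k : fieldType) (T Q : lmodType k) (E : T -> Prop)
    (pi : {linear T -> Q}) : Prop :=
  (forall q, exists t, pi t = q) /\ (forall t, pi t = 0 <-> E t).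

(** * The complete 3-uniform hypergraph on six vertices *)

(* The vertex i of {1, ..., 6} is the ordinal i - 1. *)
Definition vtx (i : nat) : 'I_6 := inord i.-1.

(* The hyperedge {i, j, k} also stands for the index (i, j, k), i < j < k. *)
Definition hedge : Type := {a : {set 'I_6} | #|a| == 3}.
HB.instance Definition _ := Finite.on hedge.

Lemma card_set3 (T : finType) (x y z : T) :
  uniq [:: x; y; z] -> #|[set x; y; z]| == 3%N.
Proof.
move=> u; rewrite -[3%N]/(size [:: x; y; z]) -(card_uniqP u); apply/eqP.
by apply: eq_card => w; rewrite !inE orbA.
Qed.

Lemma hedge0_subproof : #|[set vtx 1; vtx 2; vtx 3]| == 3.
Proof. by apply: card_set3; rewrite /= !inE -!val_eqE /= !inordK. Qed.

Definition hedge0 : hedge := exist _ [set vtx 1; vtx 2; vtx 3] hedge0_subproof.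

(* The default value [hedge0] is used only if x, y, z are not distinct. *)
Definition edge (x y z : 'I_6) : hedge := insubd hedge0 [set x; y; z].

Lemma val_edge (x y z : 'I_6) :
  uniq [:: x; y; z] -> val (edge x y z) = [set x; y; z].
Proof. by move=> u; rewrite val_insubd card_set3. Qed.

Lemma card_hedge : #|{: hedge}| = 20%N.
Proof.
have <- : 'C(#|{: 'I_6}|, 3) = 20%N by rewrite card_ord.
by rewrite card_sig -card_draws cardsE; apply: eq_card => a; rewrite !inE.
Qed.

Definition tetra (x y z t : 'I_6) : seq hedge :=
  [:: edge x y z; edge x y t; edge x z t; edge y z t].

(** * Homogeneous 2-partitions *)

Definition is_hpart (P : {set hedge} * {set hedge}) : bool :=
  [&& [disjoint P.1 & P.2], P.1 :|: P.2 == [set: hedge],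
      #|P.1| == 10 & #|P.2| == 10].

Definition hpart : Type := {P : {set hedge} * {set hedge} | is_hpart P}.
HB.instance Definition _ := Finite.on hpart.

Definition Pair (P : hpart) (x y z t : 'I_6) : {set hpart} :=
  [set K : hpart | [forall a : hedge, (a \notin tetra x y z t) ==>
     ((a \in (val K).1) == (a \in (val P).1)) &&
     ((a \in (val K).2) == (a \in (val P).2))]].

Definition P1_triples : seq (nat * nat * nat) :=
  [:: (1, 2, 3); (1, 2, 4); (1, 3, 4); (1, 2, 5); (3, 4, 5);
      (1, 5, 6); (2, 4, 6); (2, 5, 6); (3, 4, 6); (4, 5, 6)]%N.

Definition P1_seq : seq hedge :=
  [seq edge (vtx a.1.1) (vtx a.1.2) (vtx a.2) | a <- P1_triples].

Definition P1_left : {set hedge} := [set a in P1_seq].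

Lemma P1_subproof : is_hpart (P1_left, ~: P1_left).
Proof.
have vtxE i j : i \in iota 1 6 -> j \in iota 1 6 ->
    (vtx i == vtx j) = (i == j).
  rewrite !mem_iota -val_eqE => /andP[i1 i6] /andP[j1 j6].
  by rewrite /= !inordK ?prednK // -eqSS !prednK.
pose code (a : hedge) := [seq vtx i \in val a | i <- iota 1 6].
pose codeN (a : nat * nat * nat) :=
  [seq [|| i == a.1.1, i == a.1.2 | i == a.2] | i <- iota 1 6].
pose ok (a : nat * nat * nat) :=
  uniq [:: a.1.1; a.1.2; a.2] && all (mem (iota 1 6)) [:: a.1.1; a.1.2; a.2].
have uP1 : uniq P1_seq.
  apply: (@map_uniq _ _ code); rewrite /P1_seq -map_comp.
  have okP1 : all ok P1_triples by vm_compute.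
  suff /eq_in_map -> : {in P1_triples, code \o (fun a =>
      edge (vtx a.1.1) (vtx a.1.2) (vtx a.2)) =1 codeN} by vm_compute.
  move=> [[i j] l] /(allP okP1)/andP[u /and4P[iI jI lI _]] /=.
  apply/eq_in_map => m mI; rewrite val_edge.
    by rewrite !in_setU !in_set1 !vtxE // orbA.
  by move: u; rewrite /= !in_cons !in_nil !vtxE.
have cardE (s : seq hedge) : uniq s -> #|[set a in s]| = size s.
  by move=> us; rewrite cardsE (card_uniqP us).
have c10 : #|P1_left| = 10%N.
  by rewrite /P1_left (cardE _ uP1) /P1_seq size_map.
rewrite /is_hpart /= -setI_eq0 setICr eqxx setUCr eqxx c10 /=.
by rewrite -(eqn_add2l #|P1_left|) cardsC c10 card_hedge.
Qed.

Definition P1 : hpart := exist _ (P1_left, ~: P1_left) P1_subproof.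

Definition is_epsS3 (eps : {ffun hpart -> int}) : Prop :=
  [/\ forall P, eps P \in [:: -4; -1; 0; 1],
      forall (P : hpart) (x y z t : 'I_6), (x < y)%N -> (y < z)%N -> (z < t)%N ->
        \sum_(K in Pair P x y z t) eps K = 0
    & eps P1 = 1].

(* The map characterized by [is_epsS3] (the default value 0 would be taken only
   if there were no such map). *)
Definition epsS3 : {ffun hpart -> int} :=
  classical_sets.xget [ffun=> 0] is_epsS3.

(** * Nontrivial partitions *)

Definition contains (H : {set hedge}) (s : seq hedge) : bool :=
  all (fun a => a \in H) s.

Definition conf_a (H : {set hedge}) : bool :=
  [exists x, exists y, exists z, exists t, uniq [:: x; y; z; t] &&
    contains H (tetra x y z t)].

Definition conf_b (H : {set hedge}) : bool :=
  [exists x, exists y, exists z, exists t, exists u,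
    uniq [:: x; y; z; t; u] &&
    contains H [:: edge x y z; edge x y t; edge x z t;
                   edge y z u; edge y t u; edge z t u]].

Definition conf_c (H : {set hedge}) : bool :=
  [exists x, exists y, exists z, exists t, exists u, exists v,
    uniq [:: x; y; z; t; u; v] &&
    contains H [:: edge x y u; edge x y v; edge y z u; edge x z u;
                   edge x t v; edge y t v; edge y z t; edge x z t]].

Definition conf_d (H : {set hedge}) : bool :=
  [exists x, exists y, exists z, exists t, exists u, exists v,
    uniq [:: x; y; z; t; u; v] &&
    contains H [:: edge x y z; edge x y t; edge x z t; edge x y u; edge y t u;
                   edge x y v; edge x u v; edge y z v; edge z t v; edge t u v]].

Definition has_conf (H : {set hedge}) : bool :=
  [|| conf_a H, conf_b H, conf_c H | conf_d H].

Definition nontrivial (P : hpart) : bool :=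
  ~~ has_conf (val P).1 && ~~ has_conf (val P).2.

(** * The map det^{S^3} on simple tensors *)

Definition monomial (k : fieldType) (V : vectType k) (e : 2.-tuple V)
    (P : hpart) (v : {ffun hedge -> V}) : k :=
  (\prod_(a in (val P).1) coord e 0 (v a)) *
  (\prod_(a in (val P).2) coord e 1 (v a)).

Definition detS3_form (k : fieldType) (V : vectType k) (e : 2.-tuple V)
    (v : {ffun hedge -> V}) : k :=
  \sum_(P : hpart | nontrivial P) (epsS3 P)%:~R * monomial e P v.

Lemma detS3_form_multilinear (k : fieldType) (V : vectType k)
    (e : 2.-tuple V) : multilinear (detS3_form e : _ -> k^o).
Proof.
move=> i v a x y; rewrite /detS3_form scaler_sumr -big_split /=.
apply: eq_bigr => P _.
have mE w : monomial e P w =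
    \prod_b coord e (if b \in (val P).1 then 0 else 1) (w b).
  rewrite /monomial (bigID (fun b => b \in (val P).1) predT) /=.
  have /and4P[/pred0P dP /eqP uP _ _] := valP P.
  congr (_ * _); first by apply: eq_bigr => b ->.
  have P2 b : (b \in (val P).2) = (b \notin (val P).1).
    have /= := dP b; have := in_setT b; rewrite -uP inE.
    by case: (b \in (val P).1); case: (b \in (val P).2).
  by apply: eq_big => // b; rewrite P2 => /negPf ->.
rewrite !mE (prod_coord_multilinear e _ i v a x y).
by rewrite mulrDr; congr (_ + _); rewrite [LHS]mulrCA.
Qed.

Definition degenerate (V : Type) (v : {ffun hedge -> V}) : Prop :=
  exists x y z t : 'I_6,
    [/\ (x < y)%N, (y < z)%N & (z < t)%N] /\
    [/\ v (edge x y z) = v (edge x y t), v (edge x y t) = v (edge x z t)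
      & v (edge x z t) = v (edge y z t)].

Definition ES3 (k : fieldType) (V T : lmodType k)
    (tens : {ffun hedge -> V} -> T) : T -> Prop :=
  in_span (fun t => exists2 v, degenerate v & t = tens v).

Definition vanishes_on_degenerate (k : fieldType) (V T : lmodType k)
    (tens : {ffun hedge -> V} -> T) (f : T -> k) : Prop :=
  forall v : {ffun hedge -> V}, degenerate v -> f (tens v) = 0.

(* Main.v *)
Require Import Defs.
From HB Require Import structures.
From mathcomp Require Import all_boot all_order all_algebra perm.
From mathcomp Require Import ring zify.
From mathcomp Require classical_sets cardinality.

Set Implicit Arguments.
Unset Strict Implicit.
Unset Printing Implicit Defensive.

Import Order.TTheory GRing.Theory Num.Theory.
Local Open Scope ring_scope.

(** Write [c] for a colouring of the 20 triples by {e_1, e_2}. A linear form on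
    the tensor power that kills degenerate tensors is a function of colourings
    such that, for every tetrahedron, the sum over the colourings that agree off
    its four faces and have the same number of e_2's is zero.

    One such function is explicit. For the boundary matrix B of the 2-skeleton
    of the simplex on {1, ..., 5} (rows: triples t, columns: pairs p), the
    10 x 10 determinant of the matrix B(t, p) [v_t, v_(p + 6)], where [u, w] is
    the 2 x 2 bracket, is multilinear in the 20 vectors. It vanishes on
    degenerate families: if v is constant on the faces of a tetrahedron, the
    part in {1, ..., 5} of the boundary of this tetrahedron is a linear relation
    between the rows.

    For uniqueness, order the colourings lexicographically. Every colouring but
    one ([root_colouring]) is expressed, through at most three nested relations,
    by smaller colourings and colourings with a monochromatic tetrahedron; a
    search over partial colourings checks this. Hence a solution vanishing at
    this colouring is zero. Uniqueness makes the determinant invariant under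
    S_6, so its values need only be computed for a few hundred colourings. *)

(** * Linear forms on spans, quotients and tensor powers *)

Section SpansAndQuotients.

Variables (k : fieldType) (T : lmodType k).

Lemma mem_in_span (S : T -> Prop) (t : T) : S t -> in_span S t.
Proof.
move=> St; exists 1%N, (fun=> 1), (fun=> t); split=> //.
by rewrite big_ord1 scale1r.
Qed.

Lemma linear_in_span0 (W : lmodType k) (f : {linear T -> W}) (S : T -> Prop) :
  (forall s, S s -> f s = 0) -> forall t, in_span S t -> f t = 0.
Proof.
move=> f0 _ [n [c [s [Ss ->]]]]; rewrite linear_sum big1 // => i _.
by rewrite linearZ /= f0 // scaler0.
Qed.

Lemma quotient_lift (L W : lmodType k) (E : T -> Prop) (proj : {linear T -> L})
    (f : {linear T -> W}) :
  is_quotient E proj -> (forall t, E t -> f t = 0) ->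
  exists g : {linear L -> W}, forall t, g (proj t) = f t.
Proof.
move=> [surj ker] f0.
have preim q : exists t, proj t == q by have [t <-] := surj q; exists t.
pose g q := f (xchoose (preim q)).
have gE t : g (proj t) = f t.
  apply/eqP; rewrite -subr_eq0 -linearB; apply/eqP/f0/ker.
  by rewrite linearB (eqP (xchooseP (preim _))) subrr.
have g_linear : linear g.
  move=> a q r; have [t <-] := surj q; have [u <-] := surj r.
  by rewrite -linearP !gE linearP.
pose gM := GRing.isLinear.Build k L W *:%R g g_linear.
by exists (HB.pack g gM : {linear L -> W}).
Qed.

Lemma quotient_unique_form (L : lmodType k) (S : T -> Prop)
    (proj : {linear T -> L}) (D : {linear T -> k^o}) :
    is_quotient (in_span S) proj -> (exists t, D t <> 0) ->
    (forall s, S s -> D s = 0) ->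
    (forall f : {linear T -> k^o}, (forall s, S s -> f s = 0) ->
       exists c : k, forall t, f t = c * D t) ->
  exists D' : {linear L -> k^o},
    [/\ forall t, D' (proj t) = D t, exists q, D' q <> 0
      & forall f : {linear L -> k^o}, exists c : k, forall q, f q = c * D' q].
Proof.
move=> quot [t Dt] D0 uniqD; have [surj ker] := quot.
have [D' D'E] := quotient_lift quot (linear_in_span0 D0).
exists D'; split=> //; first by exists (proj t); rewrite D'E.
move=> f; have [|c fE] := uniqD (f \o proj)%FUN.
  by move=> s Ss /=; rewrite (ker s).2 ?linear0 //; apply: mem_in_span.
by exists c => q; have [u <-] := surj q; rewrite D'E -fE.
Qed.

End SpansAndQuotients.

Section TensorForms.

Variables (k : fieldType) (I : finType) (V T W : lmodType k).
Variable tens : {ffun I -> V} -> T.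
Hypothesis T_tensor : is_tensor_power tens.

Lemma tensor_linear_multilinear (f : {linear T -> W}) :
  multilinear (fun v => f (tens v)).
Proof. by move=> i v a x y; rewrite T_tensor.1 linearP. Qed.

Lemma tensor_linear_ext (f g : {linear T -> W}) :
  (forall v, f (tens v) = g (tens v)) -> f =1 g.
Proof.
have [h [_ h_uniq]] := T_tensor.2 _ _ (tensor_linear_multilinear g).
by move=> fg t; rewrite (h_uniq f fg) (h_uniq g).
Qed.

End TensorForms.

(** * Exchange relations *)

Section Exchange.

Variable I : finType.
Implicit Types (B : {set I}) (c d : {ffun I -> bool}).

Definition weight c : nat := (\sum_a c a)%N.

Definition agree_off B c d : bool := [forall (a | a \notin B), d a == c a].

Definition exchange B c d : bool := agree_off B c d && (weight d == weight c).

Definition exchange_balanced (R : zmodType) B (F : {ffun I -> bool} -> R) :=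
  forall c, \sum_(d | exchange B c d) F d = 0.

Lemma agree_offP B c d :
  reflect (forall a, a \notin B -> d a = c a) (agree_off B c d).
Proof. by apply: (iffP forall_inP) => dc a /dc/eqP. Qed.

Lemma exchange_refl B c : exchange B c c.
Proof. by rewrite /exchange eqxx andbT; apply/agree_offP. Qed.

Lemma exchangeP B c d :
  reflect ((forall a, a \notin B -> d a = c a) /\ weight d = weight c)
          (exchange B c d).
Proof.
by apply: (iffP andP) => -[/agree_offP dc /eqP wd]; split.
Qed.

Lemma weight_max c : (weight c <= #|I|)%N.
Proof. by rewrite -sum1_card; apply: leq_sum => a _; case: (c a). Qed.

Lemma weight_set (A : {set I}) : weight [ffun a => a \in A] = #|A|.
Proof.
rewrite -sum1_card big_mkcond; apply: eq_bigr => a _.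
by rewrite ffunE; case: (a \in A).
Qed.

Lemma weight_reindex (h : I -> I) c : injective h ->
  weight [ffun a => c (h a)] = weight c.
Proof.
move=> h_inj; rewrite /weight [RHS](reindex_inj h_inj).
by apply: eq_bigr => a _; rewrite ffunE.
Qed.

(* All the changes from [c] to [d] go from [b] to [~~ b]. *)
Lemma eq_of_monotone_change (b : bool) c d :
  (forall a, c a = b \/ d a = c a) -> weight d = weight c -> d = c.
Proof.
have eq_of_le c1 d1 :
    (forall a, d1 a -> c1 a) -> weight d1 = weight c1 -> d1 = c1.
  move=> le wd; have [a _|_] := @leqif_sum _ predT (fun a => d1 a == c1 a)
      (fun a => nat_of_bool (d1 a)) (fun a => nat_of_bool (c1 a)).
    by have := le a; case: (d1 a); case: (c1 a) => // /(_ isT).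
  rewrite -/(weight d1) -/(weight c1) wd eqxx => /esym/forallP dc.
  by apply/ffunP => a; apply/eqP/dc.
case: b => cd wd; first by apply: eq_of_le wd => a; case: (cd a) => ->.
by apply/esym; apply: eq_of_le (esym wd) => a; case: (cd a) => ->.
Qed.

Section Balanced.

Variables (R : zmodType) (F : {ffun I -> bool} -> R) (B : {set I}).
Hypothesis F_balanced : exchange_balanced B F.

Lemma exchange_balanced_isolated c :
  (forall d, exchange B c d -> d != c -> F d = 0) -> F c = 0.
Proof.
move=> Fd; have := F_balanced c; rewrite (bigD1 c) ?exchange_refl //=.
by rewrite big1 ?addr0 // => d /andP[]; apply: Fd.
Qed.

Lemma exchange_balanced_monochromatic c b :
  (forall a, a \in B -> c a = b) -> F c = 0.
Proof.
move=> cB; apply: exchange_balanced_isolated => d /exchangeP[dc wd] /eqP[].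
apply: (eq_of_monotone_change (b := b)) wd => a.
by case: (boolP (a \in B)) => [/cB|/dc]; [left | right].
Qed.

(* If [z] has the other colour in [c], every other colouring in the relation
   gives the colour [b] to [z]. *)
Lemma exchange_balanced_all_but_one c b z :
  (forall a, a \in B -> a != z -> c a = b) ->
  (forall d, agree_off B c d -> d z = b -> F d = 0) ->
  F c = 0.
Proof.
move=> cB Fz; have [cz|cz] := eqVneq (c z) b.
  by apply: Fz => //; apply/agree_offP.
apply: exchange_balanced_isolated => d /exchangeP[dc wd] ncd.
apply: Fz; first exact/agree_offP.
apply: contra_neq_eq ncd => dz.
apply: (eq_of_monotone_change (b := b)) wd => a.
case: (boolP (a \in B)) => [aB|/dc]; last by right.
have [->|az] := eqVneq a z; last by left; apply: cB.
by right; case: (b) (d z) (c z) cz dz => [] [] [].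
Qed.

Lemma exchange_balanced_weight (n : nat) :
  exchange_balanced B (fun c => if weight c == n then F c else 0).
Proof.
move=> c; have [wc|wc] := eqVneq (weight c) n.
  rewrite -[RHS](F_balanced c); apply: eq_bigr => d /exchangeP[_ ->].
  by rewrite wc eqxx.
by rewrite big1 // => d /exchangeP[_ ->]; rewrite (negPf wc).
Qed.

End Balanced.

Lemma exchange_balancedB (R : zmodType) B (F G : {ffun I -> bool} -> R) :
  exchange_balanced B F -> exchange_balanced B G ->
  exchange_balanced B (fun c => F c - G c).
Proof. by move=> balF balG c; rewrite sumrB balF balG subrr. Qed.

Lemma exchange_balanced_reindex (R : zmodType) B F (h : I -> I) : injective h ->
  exchange_balanced (h @^-1: B) F ->
  exchange_balanced (R := R) B (fun c => F [ffun a => c (h a)]).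
Proof.
move=> h_inj balF c; pose act c : {ffun I -> bool} := [ffun a => c (h a)].
have act_inj : injective act.
  move=> d d' /ffunP dd'; apply/ffunP => a.
  by have := dd' (invF h_inj a); rewrite !ffunE f_invF.
have act_exchange d : exchange (h @^-1: B) (act c) (act d) = exchange B c d.
  rewrite /exchange !weight_reindex //; congr (_ && _).
  apply/agree_offP/agree_offP => dc a aB.
    by have := dc (invF h_inj a); rewrite !inE !ffunE f_invF; apply.
  by rewrite !ffunE dc //; rewrite inE in aB.
have act_bij : bijective act := injF_bij act_inj.
rewrite -[RHS](balF (act c)) [RHS](reindex act) /=; last exact: onW_bij.
by apply: eq_bigl => d; rewrite act_exchange.
Qed.

End Exchange.

Lemma uniq_natr_seq (R : numDomainType) n : uniq [seq i%:R : R | i <- iota 0 n].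
Proof.
by rewrite map_inj_uniq ?iota_uniq // => i j /eqP; rewrite eqr_nat => /eqP.
Qed.

Lemma infinite_uniq_seq (T : choiceType) :
  ~ cardinality.finite_set (@classical_sets.setT T) ->
  forall n, exists2 s : seq T, uniq s & size s = n.
Proof.
move=> T_infinite n.
have [B _ Bn] := cardinality.infinite_set_fset n T_infinite.
exists (take n (finmap.enum_fset B)); last by rewrite size_takel.
exact/take_uniq/finmap.fset_uniq.
Qed.

Section MultilinearExchange.

Variables (k : fieldType) (V : vectType k) (e : 2.-tuple V).
Hypothesis e_basis : basis_of fullv e.

Definition bool_ord (b : bool) : 'I_2 := if b then 1 else 0.

Lemma bool_ord_bij : bijective bool_ord.
Proof.
exists (fun i : 'I_2 => i == 1); first by case.
by move=> [[|[|]]] //= i2; apply: val_inj.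
Qed.

Definition basis_vec (b : bool) : V := tnth e (bool_ord b).

Lemma coord_basis_vec (b c : bool) :
  coord e (bool_ord b) (basis_vec c) = (c == b)%:R.
Proof.
rewrite /basis_vec (tnth_nth 0) coord_free ?(basis_free e_basis) //.
by rewrite (inj_eq (bij_inj bool_ord_bij)).
Qed.

Variable I : finType.
Implicit Types c d : {ffun I -> bool}.

Definition basis_family c : {ffun I -> V} := [ffun a => basis_vec (c a)].

Lemma prod_coord_basis_family c d :
  \prod_a coord e (bool_ord (d a)) (basis_family c a) = (c == d)%:R.
Proof.
under eq_bigr => a _ do rewrite ffunE coord_basis_vec.
have [->|] := eqVneq c d; first by rewrite big1 // => a _; rewrite eqxx.
move=> cd; suff /forallPn[a /negPf cda] : ~~ [forall a, c a == d a].
  by rewrite (bigD1 a) //= cda mul0r.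
by apply: contraNN cd => /forallP cda; apply/eqP/ffunP => a; apply/eqP.
Qed.

Lemma multilinear_basis_sum (W : lmodType k) (phi : {ffun I -> V} -> W) :
  multilinear phi ->
  forall v, phi v = \sum_(d : {ffun I -> bool})
    (\prod_a coord e (bool_ord (d a)) (v a)) *: phi (basis_family d).
Proof.
move=> phiL; apply: (multilinear_ext e_basis) => // [i v r x y|c].
  rewrite scaler_sumr -big_split /=; apply: eq_bigr => d _.
  rewrite (prod_coord_multilinear e (fun a => bool_ord (d a)) i v r x y).
  by rewrite scalerDl -scalerA.
have [ord_bool _ ord_boolK] := bool_ord_bij.
have -> : [ffun a => tnth e (c a)] = basis_family [ffun a => ord_bool (c a)].
  by apply/ffunP => a; rewrite !ffunE /basis_vec ord_boolK.
set d0 : {ffun I -> bool} := [ffun a => _]; rewrite (bigD1 d0) //=.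
rewrite prod_coord_basis_family eqxx scale1r big1 ?addr0 // => d.
by rewrite prod_coord_basis_family eq_sym => /negPf ->; rewrite scale0r.
Qed.

Section Pencil.

Variables (B : {set I}) (phi : {ffun I -> V} -> k^o).
Hypothesis phiL : multilinear phi.

(* The value at [x] of a family which is constant on [B], chosen so that a
   multilinear form at it is the generating function of the exchange sums. *)
Definition pencil c (x : k) : {ffun I -> V} :=
  [ffun a => if a \in B then basis_vec false + x *: basis_vec true
             else x ^+ c a *: basis_vec (c a)].

Lemma multilinear_pencil c x :
  phi (pencil c x) = \sum_(d | agree_off B c d)
    x ^+ weight d * phi (basis_family d).
Proof.
rewrite (multilinear_basis_sum phiL) [RHS]big_mkcond; apply: eq_bigr => d _.
case: ifP => [/agree_offP dc|/negbT].
  congr (_ * _); rewrite expr_sum; apply: eq_bigr => a _; rewrite ffunE.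
  case: ifP => [_|/negbT/dc dca].
    rewrite linearD linearZ /= !coord_basis_vec.
    by case: (d a); rewrite ?(mulr0, mulr1, add0r, addr0).
  by rewrite linearZ /= coord_basis_vec dca eqxx mulr1.
rewrite negb_forall_in => /exists_inP[a aB dca].
rewrite (bigD1 a) //= ffunE (negPf aB) linearZ /= coord_basis_vec eq_sym.
by rewrite (negPf dca) mulr0 mul0r scale0r.
Qed.

Lemma multilinear_exchange_balanced (s : seq k) : uniq s -> (#|I| < size s)%N ->
  (forall v : {ffun I -> V}, {in B &, forall a b, v a = v b} -> phi v = 0) ->
  exchange_balanced B (fun c => phi (basis_family c)).
Proof.
move=> s_uniq s_large phi0 c.
pose p : {poly k} := \sum_(d | agree_off B c d)
  (phi (basis_family d) : k) *: 'X^(weight d).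
have p_eq0 : p = 0.
  apply: (@roots_geq_poly_eq0 _ p s) => //.
    apply/allP => x _; rewrite rootE horner_sum.
    apply/eqP; rewrite -[RHS](phi0 (pencil c x)) ?multilinear_pencil.
      by apply: eq_bigr => d _; rewrite hornerZ hornerXn mulrC.
    by move=> a b aB bB; rewrite !ffunE aB bB.
  apply: leq_trans s_large; apply: leq_trans (size_sum _ _ _) _.
  apply/bigmax_leqP => d _; apply: leq_trans (size_scale_leq _ _) _.
  by rewrite size_polyXn ltnS weight_max.
have := coef0 k (weight c); rewrite -p_eq0 coef_sum => p_coef.
rewrite -[RHS]p_coef big_mkcondr; apply: eq_bigr => d _.
by rewrite coefZ coefXn eq_sym; case: eqP => _; rewrite ?mulr1 ?mulr0.
Qed.

End Pencil.

End MultilinearExchange.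

(** * Searching the binary tree of partial colourings *)

Local Notation lex_lt a b := (a < b :> seqlexi bool)%O.

Lemma lex_induction (n : nat) (P : seq bool -> Prop) :
  (forall l, size l = n ->
     (forall l', size l' = n -> lex_lt l' l -> P l') -> P l) ->
  forall l, size l = n -> P l.
Proof.
elim: n P => [|n IH] P small l.
  by case: l => // _; apply: small => // l' _; rewrite ltxis0.
have P_false l0 : size l0 = n -> P (false :: l0).
  move: l0; apply: IH => l0 s0 P_lt; apply: small; first by rewrite /= s0.
  by case=> [|[] l'] // [s']; rewrite eqhead_ltxiE; apply: P_lt.
case: l => [|[] l] //= [sl]; last exact: P_false.
move: l sl; apply: IH => l0 s0 P_lt; apply: small; first by rewrite /= s0.
case=> [|[] l'] // [s']; last by move=> _; apply: P_false.
by rewrite eqhead_ltxiE; apply: P_lt.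
Qed.

Lemma lex_lt_cat (a b s s' : seq bool) :
  size a = size b -> lex_lt a b -> lex_lt (a ++ s) (b ++ s').
Proof.
elim: a b => [|x a IH] [|y b] //= [sab]; rewrite !ltxi_cons.
by case/andP=> -> /implyP lt /=; apply/implyP => /lt/IH; apply.
Qed.

(* Unlike [orb] and [andb], these do not evaluate their second argument under
   [vm_compute] when the first one decides; likewise for [lazy_has] and
   [lazy_all]. *)
Local Notation "a ||| b" := (if a then true else b)
  (at level 50, left associativity).
Local Notation "a &&& b" := (if a then b else false)
  (at level 40, left associativity).

Definition lazy_has (T : Type) (a : pred T) (s : seq T) : bool :=
  (find a s < size s)%N.

Definition lazy_all (T : Type) (a : pred T) (s : seq T) : bool :=
  ~~ lazy_has (predC a) s.

Lemma lazy_hasE (T : Type) (a : pred T) s : lazy_has a s = has a s.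
Proof. by rewrite has_find. Qed.

Lemma lazy_allE (T : Type) (a : pred T) s : lazy_all a s = all a s.
Proof. by rewrite /lazy_all lazy_hasE has_predC negbK. Qed.

Fixpoint prefix_covered (stop : pred (seq bool)) (n : nat) (p : seq bool) :
    bool :=
  stop p ||| if n is n'.+1 then
    prefix_covered stop n' (rcons p false) &&&
    prefix_covered stop n' (rcons p true)
  else false.

Lemma prefix_coveredP (stop : pred (seq bool)) n p s :
  prefix_covered stop n p -> size s = n ->
  exists p' s', p ++ s = p' ++ s' /\ stop p'.
Proof.
elim: n p s => [|n IH] p s /=.
  by case: ifP => // stop_p _; exists p, s.
case: ifP => [stop_p _ _|_]; first by exists p, s.
case: ifP => // cov0 cov1; case: s => // x s [sn]; rewrite -cat_rcons.
by apply: IH => //; case: x.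
Qed.

Lemma prefix_covered_induction (stop : pred (seq bool)) n
    (P : seq bool -> Prop) :
  prefix_covered stop n [::] ->
  (forall p s, stop p -> size (p ++ s) = n ->
     (forall l, size l = n -> lex_lt l (p ++ s) -> P l) -> P (p ++ s)) ->
  forall l, size l = n -> P l.
Proof.
move=> cov sound; apply: lex_induction => l sl small.
have [p [s [/= lE stop_p]]] := prefix_coveredP cov sl.
by rewrite lE; apply: sound; rewrite -?lE.
Qed.

Definition restrict (c : seq bool) (t : seq nat) : seq bool :=
  [seq nth false c i | i <- t].

Fixpoint overwrite (t : seq nat) (b c : seq bool) : seq bool :=
  match t, b with
  | i :: t', x :: b' => set_nth false (overwrite t' b' c) i x
  | _, _ => c
  end.

Lemma size_overwrite t b c : all (gtn (size c)) t ->
  size (overwrite t b c) = size c.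
Proof.
elim: t b => [|i t IH] [|x b] //= /andP[ic tc].
by rewrite size_set_nth IH //; apply/maxn_idPr.
Qed.

Lemma nth_overwrite t b c i : size b = size t ->
  nth false (overwrite t b c) i = nth (nth false c i) b (index i t).
Proof.
elim: t b => [|j t IH] [|x b] //= [sb]; rewrite nth_set_nth /= eq_sym.
by case: eqP => //= _; rewrite IH.
Qed.

Lemma overwrite_cat t b c s : all (gtn (size c)) t ->
  overwrite t b (c ++ s) = overwrite t b c ++ s.
Proof.
have set_nth_cat (u v : seq bool) i x : (i < size u)%N ->
    set_nth false (u ++ v) i x = set_nth false u i x ++ v.
  by elim: u i => [|y u IHu] [|i] //= lt; rewrite IHu.
elim: t b => [|i t IH] [|x b] //= /andP[ic tc].
by rewrite IH // set_nth_cat // size_overwrite.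
Qed.

Lemma restrict_cat c s t : all (gtn (size c)) t ->
  restrict (c ++ s) t = restrict c t.
Proof.
by move/allP=> tc; apply/eq_in_map => i /tc /= ic; rewrite nth_cat ic.
Qed.

Lemma overwrite_restrict t l m : size m = size l -> all (gtn (size l)) t ->
  (forall i, i \notin t -> nth false m i = nth false l i) ->
  overwrite t (restrict m t) l = m.
Proof.
move=> sm tl m_off.
apply: (@eq_from_nth _ false); rewrite ?size_overwrite // => i _.
rewrite nth_overwrite ?size_map //; have [it|it] := boolP (i \in t).
  by rewrite (nth_map 0%N) ?index_mem // nth_index.
by rewrite nth_default ?m_off // size_map leqNgt index_mem.
Qed.

(* The colourings other than [c] in the exchange relation of the block [t]. *)
Definition exchanges (c : seq bool) (t : seq nat) : seq (seq bool) :=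
  [seq overwrite t b c | b <- permutations (restrict c t) & b != restrict c t].

Lemma exchanges_cat c s t : all (gtn (size c)) t ->
  exchanges (c ++ s) t = [seq q ++ s | q <- exchanges c t].
Proof.
move=> tc; rewrite /exchanges restrict_cat // -map_comp.
by apply: eq_map => b /=; rewrite overwrite_cat.
Qed.

Lemma size_exchanges c t q : all (gtn (size c)) t -> q \in exchanges c t ->
  size q = size c.
Proof. by move=> tc /mapP[b _ ->]; rewrite size_overwrite. Qed.

Lemma constant_exchanges c t : constant (restrict c t) -> exchanges c t = [::].
Proof.
rewrite /exchanges; case: (restrict c t) => [|x l] //= /all_pred1P lE.
rewrite (@eq_in_filter _ _ pred0) ?filter_pred0 // => b.
rewrite mem_permutations lE -[x :: nseq _ _]/(nseq (size l).+1 x).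
move=> perm_b; apply/negbTE; rewrite negbK.
have /all_pred1P -> : all (pred1 x) b.
  by rewrite (perm_all _ perm_b) all_nseq /= eqxx.
by rewrite (perm_size perm_b) size_nseq.
Qed.

Section BlockSearch.

Variable blocks : seq (seq nat).

Definition blocks_within (c : seq bool) : seq (seq nat) :=
  [seq t <- blocks | all (gtn (size c)) t].

Definition has_constant_block (c : seq bool) : bool :=
  has (fun t => constant (restrict c t)) (blocks_within c).

Definition resolved (known : pred (seq bool)) (c : seq bool) (t : seq nat) :
    bool :=
  lazy_all known (exchanges c t).

Definition evident (top c : seq bool) : bool :=
  lex_lt c top ||| has_constant_block c.

Fixpoint reduces (depth : nat) (top c : seq bool) : bool :=
  if depth is d.+1 then
    lazy_has (resolved (fun q => evident top q ||| reduces d top q) c)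
      (blocks_within c)
  else false.

(* A prefix is first tried with the blocks that end at its last position: the
   other ones were available at a shorter prefix. *)
Definition reducible_prefix (root : seq bool) (depth : nat) (p : seq bool) :
    bool :=
  lazy_has (resolved (evident p) p)
    [seq t <- blocks_within p | (last 0 t).+1 == size p]
  ||| ((size p == size root) &&& ((p == root) ||| reduces depth p p)).

End BlockSearch.

Lemma perm_eq_bool (a b : seq bool) :
  size a = size b -> count id a = count id b -> perm_eq a b.
Proof.
have countE (p : pred bool) l :
    count p l = (p true * count id l + p false * (size l - count id l))%N.
  rewrite -(count_predC id l) addKn.
  elim: l => [|x l IH] /=; first by rewrite !muln0.
  by rewrite IH; case: x; case: (p true); case: (p false) => /=; lia.
by move=> sab cab; apply/seq.permP => p; rewrite !(countE p) sab cab.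
Qed.

Lemma perm_restrict_split t l : uniq t -> all (gtn (size l)) t ->
  perm_eq l
    (restrict l t ++ restrict l [seq i <- iota 0 (size l) | i \notin t]).
Proof.
move=> t_uniq /allP tl; rewrite -map_cat -[X in perm_eq X]take_size.
rewrite -(map_nth_iota0 false (leqnn _)); apply: perm_map.
apply: uniq_perm; rewrite ?iota_uniq //.
  rewrite cat_uniq t_uniq filter_uniq ?iota_uniq // andbT /=.
  by apply/hasPn => i; rewrite mem_filter => /andP[].
move=> i; rewrite mem_cat mem_filter mem_iota.
by case: (boolP (i \in t)) => //= /tl.
Qed.

Lemma perm_restrict t l m : uniq t -> all (gtn (size l)) t -> size m = size l ->
  count id m = count id l ->
  (forall i, i \notin t -> nth false m i = nth false l i) ->
  perm_eq (restrict m t) (restrict l t).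
Proof.
move=> t_uniq tl sm cm m_off; have := perm_eq_bool sm cm.
rewrite (permPl (perm_restrict_split t_uniq _)) ?sm //.
rewrite (permPr (perm_restrict_split t_uniq tl)).
have -> : restrict m [seq i <- iota 0 (size l) | i \notin t] =
          restrict l [seq i <- iota 0 (size l) | i \notin t].
  by apply/eq_in_map => i; rewrite mem_filter => /andP[/m_off].
by rewrite perm_cat2r.
Qed.

Section ListColourings.

Variables (I : finType) (els : seq I).
Hypothesis els_enum : perm_eq els (enum I).
Implicit Types (l : seq bool) (t : seq nat).

Definition colouring_of l : {ffun I -> bool} :=
  [ffun a => nth false l (index a els)].

Definition block t : {set I} := [set a | index a els \in t].

Lemma mem_els a : a \in els.
Proof. by rewrite (perm_mem els_enum) mem_enum. Qed.

Lemma uniq_els : uniq els.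
Proof. by rewrite (perm_uniq els_enum) enum_uniq. Qed.

Lemma index_els_surj i : (i < size els)%N -> exists a, i = index a els.
Proof.
case: els uniq_els => // x0 els' els_uniq i_lt.
by exists (nth x0 (x0 :: els') i); rewrite index_uniq.
Qed.

Lemma nth_map_els (c : I -> bool) a : nth false (map c els) (index a els) = c a.
Proof. by rewrite (nth_map a) ?index_mem ?nth_index ?mem_els. Qed.

Lemma colouring_of_map (c : {ffun I -> bool}) : colouring_of (map c els) = c.
Proof. by apply/ffunP => a; rewrite ffunE nth_map_els. Qed.

Lemma colouring_of_nth x0 l i : (i < size els)%N ->
  colouring_of l (nth x0 els i) = nth false l i.
Proof. by move=> i_lt; rewrite ffunE index_uniq ?uniq_els. Qed.

Lemma map_colouring_of l : size l = size els -> map (colouring_of l) els = l.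
Proof.
move=> sl; apply: (@eq_from_nth _ false) => [|i]; rewrite size_map //.
by move=> /index_els_surj[a ->]; rewrite nth_map_els ffunE.
Qed.

Lemma weight_count (c : {ffun I -> bool}) : weight c = count id (map c els).
Proof.
rewrite count_map -sum1_count big_mkcond (perm_big _ els_enum) big_enum /=.
by apply: eq_bigr => a _; case: (c a).
Qed.

Lemma weight_colouring_of l : size l = size els ->
  weight (colouring_of l) = count id l.
Proof. by move=> sl; rewrite weight_count map_colouring_of. Qed.

Lemma exchange_colouring_ofP t l d : uniq t -> all (gtn (size els)) t ->
  size l = size els ->
  exchange (block t) (colouring_of l) d -> d != colouring_of l ->
  exists2 q, q \in exchanges l t & d = colouring_of q.
Proof.
move=> t_uniq t_els sl /exchangeP[d_off wd] dl; pose m := map d els.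
have sm : size m = size l by rewrite size_map.
have t_l : all (gtn (size l)) t by rewrite sl.
have m_off i : i \notin t -> nth false m i = nth false l i.
  have [/index_els_surj[a ->] ta|i_ge _] := ltnP i (size els).
    by rewrite nth_map_els d_off ?ffunE // inE.
  by rewrite !nth_default ?sm ?sl.
have mE : overwrite t (restrict m t) l = m by apply: overwrite_restrict.
exists m; last by rewrite colouring_of_map.
rewrite -mE; apply: map_f; rewrite mem_filter mem_permutations.
rewrite perm_restrict //; last by rewrite -weight_count wd weight_colouring_of.
rewrite andbT.
apply: contraNneq dl => m_t; rewrite -[d]colouring_of_map -/m -mE m_t.
by rewrite overwrite_restrict.
Qed.

Section SearchSoundness.

Variables (blocks : seq (seq nat)) (R : zmodType) (F : {ffun I -> bool} -> R).
Hypothesis blocks_uniq : all uniq blocks.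
Hypothesis F_balanced : forall t, t \in blocks -> exchange_balanced (block t) F.

Lemma resolved_eq0 (known : pred (seq bool)) p s t :
  t \in blocks_within blocks p ->
  size (p ++ s) = size els ->
  (forall q, known q -> size q = size p -> F (colouring_of (q ++ s)) = 0) ->
  resolved known p t -> F (colouring_of (p ++ s)) = 0.
Proof.
rewrite mem_filter => /andP[tp tb] sps F0.
rewrite /resolved lazy_allE => /allP p_known.
have t_els : all (gtn (size els)) t.
  by apply: sub_all tp => i /= ip; rewrite -sps size_cat ltn_addr.
apply: (exchange_balanced_isolated (F_balanced tb)) => d cd nd.
have [q] := exchange_colouring_ofP (allP blocks_uniq t tb) t_els sps cd nd.
rewrite exchanges_cat // => /mapP[r rp ->] ->.
by apply: F0 (p_known r rp) _; apply: size_exchanges rp.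
Qed.

Lemma has_constant_block_eq0 p s : size (p ++ s) = size els ->
  has_constant_block blocks p -> F (colouring_of (p ++ s)) = 0.
Proof.
move=> sps /hasP[t tp t_const]; apply: (@resolved_eq0 xpred0 p s t) => //.
by rewrite /resolved constant_exchanges.
Qed.

Section Reduction.

Variables (top s : seq bool).
Hypothesis size_top : size (top ++ s) = size els.
Hypothesis F_below :
  forall l, size l = size els -> lex_lt l (top ++ s) -> F (colouring_of l) = 0.

Lemma evident_eq0 q : size q = size top -> evident blocks top q ->
  F (colouring_of (q ++ s)) = 0.
Proof.
move=> sq; have sqs : size (q ++ s) = size els by rewrite size_cat sq -size_cat.
rewrite /evident; case: ifP => [q_lt _|_]; last exact: has_constant_block_eq0.
by apply: F_below; rewrite ?lex_lt_cat.
Qed.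

Lemma reduces_eq0 depth q : size q = size top -> reduces blocks depth top q ->
  F (colouring_of (q ++ s)) = 0.
Proof.
elim: depth q => // depth IH q sq /=; rewrite lazy_hasE => /hasP[t tq].
apply: resolved_eq0 tq _ _ => [|r]; first by rewrite size_cat sq -size_cat.
case: ifP => [r_evident _ sr|_ r_red sr].
  by apply: evident_eq0; rewrite ?sr.
by apply: IH; rewrite ?sr.
Qed.

End Reduction.

Theorem exchange_balanced_search_eq0 root depth : size root = size els ->
  prefix_covered (reducible_prefix blocks root depth) (size els) [::] ->
  F (colouring_of root) = 0 -> forall c, F c = 0.
Proof.
move=> size_root covered F_root c; rewrite -[c]colouring_of_map.
move: (map c els) (size_map c els); apply: (prefix_covered_induction covered).
move=> p s + sps F_below; rewrite /reducible_prefix; case: ifP => [|_].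
  rewrite lazy_hasE => /hasP[t]; rewrite mem_filter => /andP[_ tp] + _.
  apply: (resolved_eq0 tp sps) => q q_evident sq.
  exact: (evident_eq0 sps F_below sq q_evident).
case: eqP => // sp; have /size0nil s0 : size s = 0%N.
  by move: sps; rewrite size_cat sp size_root; lia.
case: eqP => [-> _|_ p_red]; first by rewrite s0 cats0.
exact: (reduces_eq0 sps F_below (erefl _) p_red).
Qed.

End SearchSoundness.

End ListColourings.

(** * Combinations *)

(* In colexicographic order. *)
Fixpoint combinations (k n : nat) : seq (seq nat) :=
  match k, n with
  | 0, _ => [:: [::]]
  | _, 0 => [::]
  | k'.+1, n'.+1 =>
      combinations k n' ++ [seq rcons s n' | s <- combinations k' n']
  end.

Lemma mem_combinations k n (s : seq nat) : (s \in combinations k n) =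
  [&& sorted ltn s, size s == k & all (gtn n) s].
Proof.
elim: n k s => [|n IH] [|k] s /=; try by case: s => //= x s; rewrite !andbF.
rewrite mem_cat IH; case/lastP: s => [|s x].
  by rewrite andbF orFb; apply/mapP => -[[|? ?]].
have -> : (rcons s x \in [seq rcons r n | r <- combinations k n]) =
    (x == n) && (s \in combinations k n).
  by apply/mapP/andP => [[r rk /rcons_inj[-> ->]]|[/eqP-> sk]] //; exists s.
have all_lt m p : (m <= p)%N -> all (gtn m) s -> all (gtn p) s.
  by move=> mp; apply: sub_all => i /= /leq_trans; apply.
rewrite IH size_rcons eqSS !all_rcons /= !(sorted_pairwise ltn_trans) -cats1.
rewrite pairwise_cat /= !andbT allrel1r ltnS; have [->|xn] := eqVneq x n.
  rewrite ltnn leqnn !andbF orFb /=; case: (boolP (all _ s)) => [sn|].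
    by rewrite (all_lt n).
  by rewrite !andbF.
rewrite andFb orbF ltn_neqAle xn /=.
case: (leqP x n) => [xn'|]; last by rewrite !andbF.
case: (boolP (all _ s)) => //= sx.
by rewrite (all_lt x n) // (all_lt x n.+1) // leqW.
Qed.

Lemma combinations_uniq k n : uniq (combinations k n).
Proof.
elim: n k => [|n IH] [|k] //=; rewrite cat_uniq IH map_inj_uniq ?IH; last first.
  exact: rcons_injl.
rewrite andbT /=; apply/hasPn => _ /mapP[s _ ->] /=.
by rewrite mem_combinations all_rcons /= ltnn !andbF.
Qed.

Section Combinations.

Variable n : nat.

Definition ordset (s : seq nat) : {set 'I_n} := [set x : 'I_n | val x \in s].

Definition elements (A : {set 'I_n}) : seq nat := map val (enum A).

Lemma mem_elements A (x : 'I_n) : (val x \in elements A) = (x \in A).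
Proof. by rewrite mem_map ?mem_enum //; apply: val_inj. Qed.

Lemma elementsK : cancel elements ordset.
Proof. by move=> A; apply/setP => x; rewrite inE mem_elements. Qed.

Lemma elements_sorted A : sorted ltn (elements A).
Proof.
have := iota_ltn_sorted 0 n; rewrite -val_enum_ord /elements !sorted_map.
apply: subseq_sorted => [x y z|]; first exact: ltn_trans.
by rewrite {1}/enum_mem -enumT filter_subseq.
Qed.

Lemma elements_combinations A : elements A \in combinations #|A| n.
Proof.
rewrite mem_combinations elements_sorted size_map -cardE eqxx /=.
by apply/allP => _ /mapP[x _ ->] /=.
Qed.

Lemma ordsetK k : {in combinations k n, cancel ordset elements}.
Proof.
move=> s; rewrite mem_combinations => /and3P[s_sorted _ /allP s_lt].
apply: (irr_sorted_eq ltn_trans ltnn) (elements_sorted _) s_sorted _ => i.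
apply/mapP/idP => [[x]|si]; first by rewrite mem_enum inE => xs ->.
by exists (Ordinal (s_lt i si)); rewrite // mem_enum inE.
Qed.

Lemma card_ordset k s : s \in combinations k n -> #|ordset s| = k.
Proof.
move=> sk; rewrite cardE -(size_map val) -[map _ _]/(elements _) (ordsetK sk).
by move: sk; rewrite mem_combinations => /and3P[_ /eqP].
Qed.

Lemma imset_ordset (f : 'I_n -> 'I_n) (g : nat -> nat) s :
  (forall x, val (f x) = g (val x)) -> all (gtn n) s ->
  f @: ordset s = ordset (map g s).
Proof.
move=> fg /allP s_lt; apply/setP => y; rewrite inE.
apply/imsetP/mapP => [[x xs ->]|[i si yi]].
  by exists (val x); rewrite // inE in xs *.
have i_lt : (i < n)%N by apply: s_lt.
by exists (Ordinal i_lt); rewrite ?inE //; apply: val_inj; rewrite fg.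
Qed.

Lemma set4P (A : {set 'I_n}) : #|A| = 4%N ->
  exists x y z t : 'I_n,
    [/\ (x < y)%N, (y < z)%N & (z < t)%N] /\ A = [set x; y; z; t].
Proof.
move: (elements_sorted A); rewrite /elements cardE.
have : A = [set x in enum A] by apply/setP => x; rewrite inE mem_enum.
case: (enum A) => [|x [|y [|z [|t [|? ?]]]]] //= AE /and4P[xy yz zt _] _.
exists x, y, z, t; split=> //; rewrite AE.
by apply/setP => i; rewrite !inE !orbA.
Qed.

Lemma card_set4 (x y z t : 'I_n) : uniq [:: x; y; z; t] ->
  #|[set x; y; z; t]| = 4%N.
Proof.
move=> xyzt_uniq; rewrite -[RHS](card_uniqP xyzt_uniq).
by apply: eq_card => b; rewrite !inE !orbA.
Qed.

Lemma lt4_uniq (x y z t : 'I_n) : (x < y)%N -> (y < z)%N -> (z < t)%N ->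
  uniq [:: x; y; z; t].
Proof.
move=> xy yz zt; rewrite -(map_inj_uniq val_inj).
by apply: (sorted_uniq ltn_trans ltnn); rewrite /= xy yz zt.
Qed.

End Combinations.

Lemma all_iotaP (p : pred nat) n :
  reflect (forall i, (i < n)%N -> p i) (all p (iota 0 n)).
Proof.
apply: (iffP allP) => p_lt i; last by rewrite mem_iota; apply: p_lt.
by move=> i_lt; apply: p_lt; rewrite mem_iota.
Qed.

Lemma uniq_map_nth (T : eqType) (x0 : T) w s :
  uniq w -> uniq s -> all (gtn (size w)) s -> uniq (map (nth x0 w) s).
Proof.
move=> w_uniq s_uniq /allP s_lt; rewrite map_inj_in_uniq // => i j.
by move=> /s_lt i_lt /s_lt j_lt /eqP; rewrite nth_uniq // => /eqP.
Qed.

(** * Hyperedges and tetrahedra *)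

(* The first ten triples are those of {0, ..., 4}, and the triple of index
   10 + j is the j-th pair of {0, ..., 4} together with 5. *)
Definition triples : seq (seq nat) := Eval vm_compute in combinations 3 6.

Definition quadruples : seq (seq nat) := Eval vm_compute in combinations 4 6.

Lemma triplesE : triples = combinations 3 6.
Proof. by []. Qed.

Lemma quadruplesE : quadruples = combinations 4 6.
Proof. by []. Qed.

Definition triple_edge (s : seq nat) : hedge := insubd hedge0 (ordset 6 s).

Definition hedges : seq hedge := map triple_edge triples.

Lemma val_triple_edge s : s \in triples -> val (triple_edge s) = ordset 6 s.
Proof. by rewrite triplesE => /card_ordset s3; rewrite val_insubd s3. Qed.

Lemma triple_edgeK :
  {in triples, cancel (fun s => val (triple_edge s)) (@elements 6)}.
Proof.
move=> s s3; rewrite val_triple_edge //.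
by move: s3; rewrite triplesE => /ordsetK.
Qed.

Lemma elements_hedge (a : hedge) : elements (val a) \in triples.
Proof.
by have := elements_combinations (val a); rewrite (eqP (valP a)).
Qed.

Lemma elements_hedgeK (a : hedge) : triple_edge (elements (val a)) = a.
Proof.
by apply: val_inj; rewrite val_triple_edge ?elements_hedge // elementsK.
Qed.

Lemma hedges_enum : perm_eq hedges (enum {: hedge}).
Proof.
apply: uniq_perm => [||a]; first 1 last.
- exact: enum_uniq.
- by rewrite mem_enum -(elements_hedgeK a) map_f ?elements_hedge.
rewrite map_inj_in_uniq ?(combinations_uniq 3 6) //.
by apply: (can_in_inj (g := fun a : hedge => elements (val a))) triple_edgeK.
Qed.

Lemma size_hedges : size hedges = 20%N.
Proof. by rewrite size_map. Qed.

Lemma mem_hedges a : a \in hedges.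
Proof. exact: mem_els hedges_enum a. Qed.

Lemma uniq_hedges : uniq hedges.
Proof. exact: uniq_els hedges_enum. Qed.

Lemma index_hedges_lt a : (index a hedges < 20)%N.
Proof. by rewrite -[20%N]size_hedges index_mem mem_hedges. Qed.

Lemma nth_triples (a : hedge) :
  nth [::] triples (index a hedges) = elements (val a).
Proof.
have a_lt : (index a hedges < size triples)%N := index_hedges_lt a.
rewrite -(triple_edgeK (mem_nth _ a_lt)).
by rewrite -(nth_map _ hedge0) // nth_index ?mem_hedges.
Qed.

Lemma edge_inord (i j l : nat) : all (gtn 6) [:: i; j; l] ->
  edge (inord i) (inord j) (inord l) = triple_edge [:: i; j; l].
Proof.
case/and4P=> i6 j6 l6 _; congr insubd; apply/setP => x.
by rewrite !inE -!val_eqE /= !inordK // orbA.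
Qed.

Definition faces (S : {set 'I_6}) : {set hedge} :=
  [set a : hedge | val a \subset S].

Definition tetra_indices (q : seq nat) : seq nat :=
  [seq i <- iota 0 20 | all (mem q) (nth [::] triples i)].

Definition tetrahedra : seq (seq nat) :=
  Eval vm_compute in map tetra_indices quadruples.

Lemma block_tetra_indices q :
  block hedges (tetra_indices q) = faces (ordset 6 q).
Proof.
apply/setP => a; rewrite !inE mem_filter mem_iota nth_triples.
rewrite leq0n index_hedges_lt !andbT; apply/allP/subsetP => [aq x xa|aq i].
  by rewrite inE; apply: aq; rewrite mem_elements.
by case/mapP=> x; rewrite mem_enum => /aq; rewrite inE => xq ->.
Qed.

Lemma mem_tetra (x y z t : 'I_6) (a : hedge) : uniq [:: x; y; z; t] ->
  (a \in tetra x y z t) = (a \in faces [set x; y; z; t]).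
Proof.
move=> xyzt_uniq; set S := [set x; y; z; t].
have val_edgeD p q r s : perm_eq [:: p; q; r; s] [:: x; y; z; t] ->
    val (edge p q r) = S :\ s.
  move=> pS; have := xyzt_uniq; rewrite -(perm_uniq pS) (cat_uniq [:: p; q; r]).
  case/and3P=> pqr_uniq /hasPn/(_ s (mem_head _ _)) s_pqr _.
  rewrite val_edge //; apply/setP => i; have := perm_mem pS i.
  rewrite !inE !orbA => <-; rewrite !inE !orbA in s_pqr.
  by have [->|_] := eqVneq i s; rewrite ?(negPf s_pqr) ?orbF.
have [Ex Ey Ez Et] : [/\ val (edge y z t) = S :\ x, val (edge x z t) = S :\ y,
    val (edge x y t) = S :\ z & val (edge x y z) = S :\ t].
  by split; apply: val_edgeD; apply/seq.permP => b /=; lia.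
have eq_val (b : hedge) : (a == b) = (val a == val b) by [].
rewrite !inE !eq_val Ex Ey Ez Et {eq_val}.
apply/idP/idP => [/or4P[]/eqP-> |aS]; try exact: subD1set.
have /cards1P[w wE] : #|S :\: val a| == 1%N.
  by rewrite cardsD (setIidPr aS) card_set4 // (eqP (valP a)).
have aE : val a = S :\ w by rewrite -wE setDDr setDv set0U (setIidPr aS).
have : w \in S :\: val a by rewrite wE set11.
by rewrite !inE aE => /andP[_ /orP[/orP[/orP[]|]|]/eqP->]; rewrite eqxx ?orbT.
Qed.

Lemma degenerateP (V : Type) (v : {ffun hedge -> V}) :
  degenerate v <-> exists S : {set 'I_6},
    #|S| = 4%N /\ {in faces S &, forall a b, v a = v b}.
Proof.
split=> [[x [y [z [t [[xy yz zt] [e1 e2 e3]]]]]]|[S [/set4P S4 vS]]].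
  have u4 := lt4_uniq xy yz zt.
  exists [set x; y; z; t]; split; first exact: card_set4.
  have vE a : a \in faces [set x; y; z; t] -> v a = v (edge x y z).
    by rewrite -mem_tetra // !inE => /or4P[]/eqP->; rewrite ?e1 ?e2 ?e3.
  by move=> a b /vE-> /vE->.
have [x [y [z [t [[xy yz zt] SE]]]]] := S4; exists x, y, z, t; split=> //.
have : all (mem (faces S)) (tetra x y z t).
  by apply/allP => a; rewrite mem_tetra ?lt4_uniq // -SE.
by case/and5P=> xyz xyt xzt yzt _; split; apply: vS.
Qed.

Local Notation colouring := {ffun hedge -> bool}.

Definition balanced (R : zmodType) (F : colouring -> R) : Prop :=
  forall S : {set 'I_6}, #|S| = 4%N -> exchange_balanced (faces S) F.

Definition root_colours : seq bool :=
  [:: false; false; false; true; false; false; true; true; false; true;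
      true; true; false; false; false; true; true; true; false; true].

Definition root_colouring : colouring := colouring_of hedges root_colours.

Lemma reducible_prefixes_cover :
  prefix_covered (reducible_prefix tetrahedra root_colours 3) 20 [::].
Proof. by vm_compute. Qed.

Lemma balanced_tetrahedra (R : zmodType) (F : colouring -> R) t :
  balanced F -> t \in tetrahedra -> exchange_balanced (block hedges t) F.
Proof.
move=> F_balanced; rewrite -[tetrahedra]/(map tetra_indices quadruples).
case/mapP=> q; rewrite quadruplesE => /card_ordset q4 ->.
by rewrite block_tetra_indices; apply: F_balanced.
Qed.

Lemma uniq_tetrahedra : all uniq tetrahedra.
Proof. by []. Qed.

Theorem balanced_eq0 (R : zmodType) (F : colouring -> R) :
  balanced F -> F root_colouring = 0 -> forall c, F c = 0.
Proof.
move=> F_balanced F_root.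
have tetra_balanced t :
    t \in tetrahedra -> exchange_balanced (block hedges t) F.
  exact: balanced_tetrahedra.
apply: (exchange_balanced_search_eq0 (depth := 3) hedges_enum uniq_tetrahedra
  tetra_balanced _ _ F_root).
  by rewrite size_hedges.
by rewrite size_hedges reducible_prefixes_cover.
Qed.

Lemma eq_balanced (R : zmodType) (F G : colouring -> R) :
  balanced F -> balanced G -> F root_colouring = G root_colouring -> F =1 G.
Proof.
move=> balF balG FG c; apply/eqP; rewrite -subr_eq0; apply/eqP.
apply: (balanced_eq0 (F := fun c => F c - G c)); last by rewrite FG subrr.
by move=> S S4; apply: exchange_balancedB; [apply: balF | apply: balG].
Qed.

(** * The bracket determinant *)

Section BilinearDeterminant.

Variables (k : fieldType) (V : lmodType k) (I : finType) (n : nat).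

Definition bilinear_det (g : 'I_n -> 'I_n -> V -> V -> k) (row col : 'I_n -> I)
    (v : {ffun I -> V}) : k :=
  \det (\matrix_(i, j) g i j (v (row i)) (v (col j))).

Lemma bilinear_det_tr g row col v :
  bilinear_det g row col v = bilinear_det (fun i j x y => g j i y x) col row v.
Proof.
rewrite /bilinear_det -det_tr; congr (\det _).
by apply/matrixP => i j; rewrite !mxE.
Qed.

Lemma bilinear_det_row g row col :
  (forall i j a x y w, g i j (a *: x + y) w = a * g i j x w + g i j y w) ->
  injective row -> (forall i j, col j != row i) ->
  forall (i : 'I_n) v a x y,
    bilinear_det g row col (update v (row i) (a *: x + y)) =
      a * bilinear_det g row col (update v (row i) x) +
      bilinear_det g row col (update v (row i) y).
Proof.
move=> g_linear row_inj row_col i v a x y; rewrite -[X in _ = _ + X]mul1r.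
have off_row z z' : row' i (\matrix_(i', j)
      g i' j (update v (row i) z (row i')) (update v (row i) z (col j))) =
    row' i (\matrix_(i', j)
      g i' j (update v (row i) z' (row i')) (update v (row i) z' (col j))).
  apply/matrixP => i' j; rewrite !mxE !ffunE (negPf (row_col _ _)).
  by rewrite (inj_eq row_inj) eq_sym (negPf (neq_lift _ _)).
apply: (determinant_multilinear (i0 := i)); [|exact: off_row..].
apply/rowP => j.
by rewrite !mxE !ffunE eqxx (negPf (row_col _ _)) g_linear mul1r.
Qed.

Lemma bilinear_det_multilinear g row col :
    (forall i j a x y w, g i j (a *: x + y) w = a * g i j x w + g i j y w) ->
    (forall i j a w x y, g i j w (a *: x + y) = a * g i j w x + g i j w y) ->
    injective row -> injective col -> (forall i j, row i != col j) ->
    (forall a, (exists i, a = row i) \/ (exists j, a = col j)) ->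
  multilinear (bilinear_det g row col : {ffun I -> V} -> k^o).
Proof.
move=> g_left g_right row_inj col_inj row_col cover b v a x y.
case: (cover b) => [[i ->]|[j ->]].
  by apply: bilinear_det_row => // i' j; rewrite eq_sym.
by rewrite !(bilinear_det_tr g); apply: bilinear_det_row.
Qed.

End BilinearDeterminant.

Definition rem_nth (T : Type) (j : nat) (s : seq T) : seq T :=
  take j s ++ drop j.+1 s.

(* The coefficient of the simplex [s] in the boundary of the simplex [t]. *)
Definition boundary_coef (s t : seq nat) : int :=
  let i := find (fun i => rem_nth i t == s) (iota 0 (size t)) in
  if (i < size t)%N then (-1) ^+ i else 0.

Definition boundary_table : seq (seq int) := Eval vm_compute in
  [seq [seq boundary_coef p t | p <- combinations 2 5] | t <- combinations 3 5].

Definition boundary (i j : nat) : int := nth 0 (nth [::] boundary_table i) j.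

Lemma nth_hedges_faces q i : i \in tetra_indices q ->
  nth hedge0 hedges i \in faces (ordset 6 q).
Proof.
move=> iq; have i_lt : (i < size hedges)%N.
  by move: iq; rewrite mem_filter mem_iota size_hedges => /and3P[].
by rewrite -block_tetra_indices inE index_uniq ?uniq_hedges.
Qed.

Definition base_edge (i : 'I_10) : hedge := nth hedge0 hedges i.

Definition star_edge (j : 'I_10) : hedge := nth hedge0 hedges (10 + j).

Lemma nth_hedges_eq (i j : nat) : (i < 20)%N -> (j < 20)%N ->
  (nth hedge0 hedges i == nth hedge0 hedges j) = (i == j).
Proof.
by move=> i_lt j_lt; rewrite nth_uniq ?size_hedges ?uniq_hedges.
Qed.

Lemma base_lt (i : 'I_10) : (i < 20)%N.
Proof. exact: ltn_trans (ltn_ord i) _. Qed.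

Lemma star_lt (j : 'I_10) : (10 + j < 20)%N.
Proof. by rewrite -[20%N]/(10 + 10)%N ltn_add2l. Qed.

Lemma base_edge_inj : injective base_edge.
Proof.
by move=> i j /eqP; rewrite nth_hedges_eq ?base_lt // => /eqP/val_inj.
Qed.

Lemma star_edge_inj : injective star_edge.
Proof.
by move=> i j /eqP; rewrite nth_hedges_eq ?star_lt // eqn_add2l => /eqP/val_inj.
Qed.

Lemma base_star_neq i j : base_edge i != star_edge j.
Proof. by rewrite nth_hedges_eq ?base_lt ?star_lt // ltn_eqF // ltn_addr. Qed.

Lemma base_star_cover a :
  (exists i, a = base_edge i) \/ (exists j, a = star_edge j).
Proof.
have aE := nth_index hedge0 (mem_hedges a); have a_lt := index_hedges_lt a.
have [lt10|ge10] := ltnP (index a hedges) 10.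
  by left; exists (Ordinal lt10); rewrite /base_edge /= aE.
have j_lt : (index a hedges - 10 < 10)%N by rewrite ltn_subLR.
right; exists (Ordinal j_lt); rewrite -[LHS]aE; congr nth.
by apply/esym/subnKC.
Qed.

Definition tetra_row (q : seq nat) : seq int :=
  [seq boundary_coef t q | t <- combinations 3 5].

Lemma tetra_row_unit q : q \in quadruples ->
  exists i : 'I_10, nth 0 (tetra_row q) i \is a GRing.unit.
Proof.
move=> q4; have /hasP[i] :
    has (fun i => nth 0 (tetra_row q) i \is a GRing.unit) (iota 0 10).
  by move: q q4; apply/allP; vm_compute.
by rewrite mem_iota => /andP[_ i_lt] w_unit; exists (Ordinal i_lt).
Qed.

Lemma tetra_row_support q (i : 'I_10) : q \in quadruples ->
  nth 0 (tetra_row q) i != 0 -> val i \in tetra_indices q.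
Proof.
move=> q4 wi; have /all_iotaP/(_ i (ltn_ord i))/orP[w0|//] :
    all (fun i => (nth 0 (tetra_row q) i == 0) || (i \in tetra_indices q))
      (iota 0 10).
  by move: q q4 {wi}; apply/allP; vm_compute.
by case/negP: wi.
Qed.

Lemma tetra_row_boundary q (j : 'I_10) : q \in quadruples ->
  (10 + j)%N \notin tetra_indices q ->
  \sum_(i < 10) nth 0 (tetra_row q) i * boundary i j = 0.
Proof.
move=> q4 jq; have /all_iotaP/(_ j (ltn_ord j))/orP[jq'|/eqP] :
    all (fun j => ((10 + j)%N \in tetra_indices q) ||
        (foldr +%R 0
          [seq nth 0 (tetra_row q) i * boundary i j | i <- iota 0 10] == 0))
      (iota 0 10).
- by move: q q4 {jq}; apply/allP; vm_compute.
- by case/negP: jq.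
by rewrite foldrE big_map -[iota 0 10]/(index_iota 0 10) big_mkord.
Qed.

Section BracketDet.

Variables (k : fieldType) (V : vectType k) (e : 2.-tuple V).

Definition bracket (x y : V) : k :=
  coord e 0 x * coord e 1 y - coord e 1 x * coord e 0 y.

Lemma bracketxx x : bracket x x = 0.
Proof. by rewrite /bracket mulrC subrr. Qed.

Definition bracket_det : {ffun hedge -> V} -> k :=
  bilinear_det (fun i j x y => (boundary i j)%:~R * bracket x y)
    base_edge star_edge.

Lemma bracket_det_multilinear : multilinear (bracket_det : _ -> k^o).
Proof.
apply: bilinear_det_multilinear => [i j a x y w|i j a w x y||||].
- by rewrite /bracket !linearP /=; ring.
- by rewrite /bracket !linearP /=; ring.
- exact: base_edge_inj.
- exact: star_edge_inj.
- exact: base_star_neq.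
- exact: base_star_cover.
Qed.

(* If [v] takes the value [u] on the faces of [q], the combination of the rows
   given by the boundary of [q] vanishes: its [j]-th entry is [u, v_j] times the
   coefficient of the [j]-th pair in the boundary of the sum of the triples of
   [q] in {0, ..., 4}, which is zero unless [v_j = u]. *)
Lemma bracket_det_degenerate v : degenerate v -> bracket_det v = 0.
Proof.
case/degenerateP => S [S4 vS].
have := elements_combinations S; rewrite S4 -quadruplesE => q4.
set q := elements S in q4.
have v_const a b : a \in tetra_indices q -> b \in tetra_indices q ->
    v (nth hedge0 hedges a) = v (nth hedge0 hedges b).
  move=> /nth_hedges_faces aS /nth_hedges_faces bS.
  by apply: vS; rewrite -(elementsK S).
pose w : 'rV[k]_10 := \row_i (nth 0 (tetra_row q) i)%:~R.
have [i0 w_unit] := tetra_row_unit q4.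
apply/eqP/det0P; exists w.
  have := rmorph_unit (intr : int -> k) w_unit; rewrite unitfE.
  by apply: contraNneq => /rowP/(_ i0)/eqP; rewrite /w !mxE.
have w_i0 : nth 0 (tetra_row q) i0 != 0.
  by apply: contraTneq w_unit => ->; rewrite unitr0.
apply/rowP => j; rewrite /w !mxE.
transitivity ((\sum_(i < 10) nth 0 (tetra_row q) i * boundary i j)%:~R *
    bracket (v (base_edge i0)) (v (star_edge j))).
  rewrite rmorph_sum mulr_suml; apply: eq_bigr => i _.
  rewrite !mxE rmorphM /= mulrA.
  have [->|wi] := eqVneq (nth 0 (tetra_row q) i) 0; first by rewrite !mul0r.
  by congr (_ * bracket _ _); apply: v_const; apply: tetra_row_support.
have [jq|jq] := boolP ((10 + j)%N \in tetra_indices q).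
  rewrite [v (star_edge j)](v_const _ i0) ?bracketxx ?mulr0 //.
  exact: tetra_row_support.
by rewrite tetra_row_boundary // mul0r.
Qed.

End BracketDet.

Definition eps_det (c : colouring) : int :=
  \det (\matrix_(i < 10, j < 10)
          (boundary i j * ((c (star_edge j))%:R - (c (base_edge i))%:R))).

Lemma bracket_det_basis_family (k : fieldType) (V : vectType k)
    (e : 2.-tuple V) c :
  basis_of fullv e -> bracket_det e (basis_family e c) = (eps_det c)%:~R.
Proof.
move=> e_basis; rewrite /bracket_det /bilinear_det /eps_det -(det_map_mx intr).
congr (\det _); apply/matrixP => i j; rewrite !mxE rmorphM rmorphB /= /bracket.
rewrite -[0 : 'I_2]/(bool_ord false) -[1 : 'I_2]/(bool_ord true) !ffunE.
rewrite !coord_basis_vec // !rmorph_nat.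
by case: (c (base_edge i)); case: (c (star_edge j)) => /=; congr (_ * _); ring.
Qed.

(** * Evaluating the bracket determinant *)

Section LaplaceExpansion.

Variable R : comNzRingType.

Fixpoint laplace_det (n : nat) (A : seq (seq R)) : R :=
  if n is n'.+1 then
    foldr (fun j acc =>
      let a := nth 0 (head [::] A) j in
      if a == 0 then acc
      else (-1) ^+ odd j * a * laplace_det n' (map (rem_nth j) (behead A))
           + acc)
    0 (iota 0 n)
  else 1.

Lemma nth_rem_nth (T : Type) (x0 : T) j s i : (j < size s)%N ->
  nth x0 (rem_nth j s) i = nth x0 s (bump j i).
Proof.
move=> js; rewrite nth_cat size_take js /bump; case: (leqP j i) => ij.
  by rewrite nth_drop addSn subnKC.
by rewrite nth_take.
Qed.

Lemma size_rem_nth (T : Type) j (s : seq T) : (j < size s)%N ->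
  size (rem_nth j s) = (size s).-1.
Proof. by move=> js; rewrite size_cat size_take js size_drop; lia. Qed.

Lemma laplace_detE n (A : seq (seq R)) :
  size A = n -> all (fun r => size r == n) A ->
  laplace_det n A = \det (\matrix_(i < n, j < n) nth 0 (nth [::] A i) j).
Proof.
elim: n A => [|n IH] A sA rA; first by rewrite det_mx00.
case: A sA rA => // r A [sA] /andP[/eqP sr /allP rA].
rewrite (expand_det_row _ ord0).
pose minor j := laplace_det n (map (rem_nth j) A).
have -> : laplace_det n.+1 (r :: A) =
    \sum_(j < n.+1) nth 0 r j * ((-1) ^+ j * minor j).
  rewrite -(big_mkord xpredT (fun j => nth 0 r j * ((-1) ^+ j * minor j))).
  rewrite /index_iota subn0 /laplace_det -/laplace_det.
  elim: (iota 0 n.+1) => [|j s IHs] /=; first by rewrite big_nil.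
  rewrite big_cons IHs; case: eqP => [->|_]; first by rewrite mul0r add0r.
  by rewrite signr_odd mulrCA !mulrA.
apply: eq_bigr => j _; rewrite mxE /cofactor add0n; congr (_ * (_ * _)).
rewrite /minor IH ?size_map //; last first.
  apply/allP => _ /mapP[r' /rA/eqP sr' ->].
  by rewrite size_rem_nth sr' ?ltn_ord.
congr (\det _); apply/matrixP => i l; rewrite !mxE.
by rewrite (nth_map [::]) ?sA // nth_rem_nth // (eqP (rA _ _)) ?mem_nth ?sA.
Qed.

End LaplaceExpansion.

Definition eps_rows (l : seq bool) : seq (seq int) :=
  [seq [seq boundary i j * ((nth false l (10 + j))%:R - (nth false l i)%:R)
       | j <- iota 0 10] | i <- iota 0 10].

Definition eps_list (l : seq bool) : int := laplace_det 10 (eps_rows l).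

Lemma eps_det_colouring_of l : size l = 20%N ->
  eps_det (colouring_of hedges l) = eps_list l.
Proof.
move=> sl; rewrite /eps_list laplace_detE //.
congr (\det _); apply/matrixP => i j; rewrite !mxE.
rewrite !(nth_map 0%N) ?size_iota // !nth_iota // !add0n.
by rewrite !(colouring_of_nth hedges_enum) ?size_hedges ?base_lt ?star_lt.
Qed.

Lemma eps_det_root : eps_det root_colouring = 1.
Proof. by rewrite eps_det_colouring_of //; vm_compute. Qed.

Lemma multilinear_balanced (k : fieldType) (V : vectType k) (e : 2.-tuple V)
    (phi : {ffun hedge -> V} -> k^o) (s : seq k) :
  basis_of fullv e -> uniq s -> (20 < size s)%N -> multilinear phi ->
  (forall v, degenerate v -> phi v = 0) ->
  balanced (fun c => phi (basis_family e c)).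
Proof.
move=> e_basis s_uniq s_large phiL phi0 S S4.
apply: (multilinear_exchange_balanced e_basis phiL s_uniq) => [|v vS].
  by rewrite card_hedge.
by apply: phi0; apply/degenerateP; exists S.
Qed.

Lemma eps_det_balanced : balanced eps_det.
Proof.
have d2 : \dim (fullv : {vspace 'rV[rat]_2}) = 2%N by rewrite dimvf.
pose e : 2.-tuple 'rV[rat]_2 := tcast d2 (vbasis fullv).
have e_basis : basis_of fullv e by rewrite val_tcast vbasisP.
have bal := multilinear_balanced e_basis (uniq_natr_seq rat 21) (erefl _)
  (bracket_det_multilinear e) (@bracket_det_degenerate _ _ e).
move=> S S4 c.
apply/eqP; rewrite -(intr_eq0 rat) rmorph_sum /= -[X in _ == X](bal S S4 c).
by apply/eqP/eq_bigr => d _; rewrite bracket_det_basis_family.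
Qed.

Theorem balanced_proportional (R : nzRingType) (F : colouring -> R) :
  balanced F -> forall c, F c = F root_colouring * (eps_det c)%:~R.
Proof.
move=> F_balanced; apply: eq_balanced => [//|S S4 c|]; last first.
  by rewrite eps_det_root mulr1.
by rewrite -mulr_sumr -rmorph_sum /= eps_det_balanced // mulr0.
Qed.

Lemma weight_root : weight root_colouring = 10%N.
Proof. by rewrite (weight_colouring_of hedges_enum) ?size_hedges. Qed.

Lemma eps_det_weight c : eps_det c != 0 -> weight c = 10%N.
Proof.
have eps10 : eps_det =1 (fun c => if weight c == 10%N then eps_det c else 0).
  apply: eq_balanced eps_det_balanced _ _ => [S S4|].
    exact: (exchange_balanced_weight (eps_det_balanced S4)).
  by rewrite weight_root.
by rewrite eps10; case: ifP => [/eqP|]; rewrite ?eqxx.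
Qed.

(** * Symmetry and the values of the bracket determinant *)

Section VertexPermutation.

Variable s : {perm 'I_6}.

Definition hedge_perm (a : hedge) : hedge := insubd hedge0 (s @: val a).

Lemma val_hedge_perm a : val (hedge_perm a) = s @: val a.
Proof. by rewrite val_insubd card_imset ?(valP a) //; apply: perm_inj. Qed.

Lemma hedge_perm_inj : injective hedge_perm.
Proof.
move=> a b /(congr1 val); rewrite !val_hedge_perm => ab.
by apply/val_inj/(imset_inj (@perm_inj _ s)).
Qed.

Definition permute (c : colouring) : colouring :=
  [ffun a => c (hedge_perm a)].

Lemma weight_permute c : weight (permute c) = weight c.
Proof. exact: weight_reindex hedge_perm_inj. Qed.

Lemma balanced_permute (R : zmodType) (F : colouring -> R) :
  balanced F -> balanced (fun c => F (permute c)).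
Proof.
move=> F_balanced S S4; apply: exchange_balanced_reindex hedge_perm_inj _.
have -> : hedge_perm @^-1: faces S = faces (s @^-1: S).
  by apply/setP => a; rewrite !inE val_hedge_perm sub_imset_pre.
by apply: F_balanced; rewrite card_preimset //; apply: perm_inj.
Qed.

End VertexPermutation.

Definition swap_nat (j i : nat) : nat :=
  if i == j then j.+1 else if i == j.+1 then j else i.

Definition adjacent_swap (j : nat) : {perm 'I_6} :=
  tperm (inord j) (inord j.+1).

Lemma adjacent_swapE j (x : 'I_6) : (j < 5)%N ->
  val (adjacent_swap j x) = swap_nat j (val x).
Proof.
move=> j5; have val_j : val (inord j : 'I_6) = j by rewrite /= inordK // ltnW.
have val_j1 : val (inord j.+1 : 'I_6) = j.+1 by rewrite /= inordK.
rewrite /swap_nat /adjacent_swap; case: tpermP => [->|->|/eqP xj /eqP xj1].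
- by rewrite val_j val_j1 eqxx.
- by rewrite val_j val_j1 gtn_eqF // eqxx.
by move: xj xj1; rewrite -!val_eqE val_j val_j1 => /negPf-> /negPf->.
Qed.

Definition swap_indices (j : nat) : seq nat :=
  [seq index (sort leq (map (swap_nat j) t)) triples | t <- triples].

Lemma swap_triples j t : (j < 5)%N -> t \in triples ->
  sort leq (map (swap_nat j) t) \in triples.
Proof.
by move=> j5; move: t; apply/allP; move: j j5; apply/all_iotaP; vm_compute.
Qed.

Lemma hedge_perm_swap j t : (j < 5)%N -> t \in triples ->
  hedge_perm (adjacent_swap j) (triple_edge t) =
  nth hedge0 hedges (index (sort leq (map (swap_nat j) t)) triples).
Proof.
move=> j5 t3; have r3 := swap_triples j5 t3.
rewrite (nth_map [::]) ?index_mem // nth_index //.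
apply: val_inj; rewrite val_hedge_perm !val_triple_edge //.
rewrite (imset_ordset (fun x => adjacent_swapE x j5)); last first.
  by move: t3; rewrite triplesE mem_combinations => /and3P[].
by apply/setP => x; rewrite !inE mem_sort.
Qed.

Lemma swap_indices_lt j i : (j < 5)%N -> (i < 20)%N ->
  (nth 0%N (swap_indices j) i < 20)%N.
Proof.
move=> j5 i_lt; rewrite (nth_map [::]) // -[20%N]/(size triples).
by rewrite index_mem swap_triples // mem_nth.
Qed.

Lemma permute_colouring_of j l : (j < 5)%N ->
  permute (adjacent_swap j) (colouring_of hedges l) =
  colouring_of hedges (restrict l (swap_indices j)).
Proof.
move=> j5; apply/ffunP => a; have a_lt := index_hedges_lt a.
have aE : hedge_perm (adjacent_swap j) a =
    nth hedge0 hedges (nth 0%N (swap_indices j) (index a hedges)).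
  rewrite [nth 0%N _ _](nth_map [::]) // nth_triples -(hedge_perm_swap j5).
    by rewrite elements_hedgeK.
  exact: elements_hedge.
rewrite !ffunE aE index_uniq ?uniq_hedges ?size_hedges ?swap_indices_lt //.
by rewrite (nth_map 0%N) // size_map.
Qed.

Lemma eps_det_swap j c : (j < 5)%N ->
  eps_det (permute (adjacent_swap j) c) = eps_det c.
Proof.
move=> j5; move: c; apply: eq_balanced.
- exact: balanced_permute eps_det_balanced.
- exact: eps_det_balanced.
rewrite permute_colouring_of // eps_det_root eps_det_colouring_of ?size_map //.
by apply/eqP; move: j j5; apply/all_iotaP; vm_compute.
Qed.

Definition eps_value (x : int) : bool := x \in [:: -4; -1; 0; 1].

(* The known values of the colouring [p] permuted by [pi] make it smaller
   than [p]. *)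
Definition permuted_lt (p : seq bool) (pi : seq nat) : bool :=
  let m := minn (size p) (find (leq (size p)) pi) in
  lex_lt (restrict p (take m pi)) (take m p).

Lemma permuted_lt_cat p s pi : (size p <= size pi)%N -> permuted_lt p pi ->
  lex_lt (restrict (p ++ s) pi) (p ++ s).
Proof.
rewrite /permuted_lt; set m := minn _ _ => p_pi lt.
have [m_p m_pi] : (m <= size p)%N /\ (m <= size pi)%N.
  by rewrite geq_minl (leq_trans (geq_minl _ _)).
have take_pi : all (gtn (size p)) (take m pi).
  rewrite -[all _ _]negbK -has_predC (@eq_has _ _ (leq (size p))) => [|i /=].
    by rewrite has_take_leq // -leqNgt geq_minr.
  by rewrite -leqNgt.
rewrite -{1}(cat_take_drop m pi) /restrict map_cat -/(restrict _ _).
rewrite restrict_cat //.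
rewrite -[X in lex_lt _ (X ++ s)](cat_take_drop m p) -catA.
by apply: lex_lt_cat lt; rewrite size_map !size_takel.
Qed.

Definition adjacent_swaps : seq (seq nat) :=
  Eval vm_compute in map swap_indices (iota 0 5).

Definition valued_prefix (p : seq bool) : bool :=
  has_constant_block tetrahedra p
  ||| (10 < count id p)%N ||| (10 < count negb p)%N
  ||| has (permuted_lt p) adjacent_swaps
  ||| ((size p == 20%N) &&& eps_value (eps_list p)).

Lemma valued_prefixes_cover : prefix_covered valued_prefix 20 [::].
Proof. by vm_compute. Qed.

Lemma eps_det_value c : eps_value (eps_det c).
Proof.
have [->//|/eps_det_weight wc] := eqVneq (eps_det c) 0.
rewrite -(colouring_of_map hedges_enum c); move: wc.
rewrite (weight_count hedges_enum).
move: (map c hedges) (size_map c hedges); rewrite size_hedges.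
apply: (prefix_covered_induction valued_prefixes_cover) => p s + sps small ps10.
have ps20 : size (p ++ s) = size hedges by rewrite sps size_hedges.
move/orP=> [/orP[/orP[/orP[p_const|p_true]|p_false]|/hasP[pi]]|].
- suff -> : eps_det (colouring_of hedges (p ++ s)) = 0 by [].
  apply: (has_constant_block_eq0 hedges_enum uniq_tetrahedra) p_const => // t.
  exact: balanced_tetrahedra eps_det_balanced.
- by move: ps10 p_true; rewrite count_cat; lia.
- have := count_predC id (p ++ s); rewrite ps10 sps.
  by rewrite -[count _ _]/(count negb (p ++ s)) count_cat; lia.
- rewrite -[adjacent_swaps]/(map swap_indices (iota 0 5)) => /mapP[j].
  rewrite mem_iota => j5 -> p_lt.
  rewrite -(eps_det_swap _ j5) permute_colouring_of //.
  apply: small; first by rewrite size_map.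
    apply: permuted_lt_cat p_lt.
    by rewrite size_map -[size triples]sps size_cat leq_addr.
  rewrite -(weight_colouring_of hedges_enum) ?size_map ?size_hedges //.
  rewrite -permute_colouring_of // weight_permute.
  by rewrite (weight_colouring_of hedges_enum).
case/andP=> /eqP sp p_value; have /size0nil-> : size s = 0%N.
  by move: sps; rewrite size_cat sp; lia.
by rewrite cats0 eps_det_colouring_of.
Qed.

(** * Monochromatic configurations *)

Definition monochromatic (b : bool) (c : colouring) (s : seq hedge) : bool :=
  all (fun a => c a == b) s.

Definition edge_along (w : seq 'I_6) (s : seq nat) : hedge :=
  insubd hedge0 [set x in map (nth ord0 w) s].

Lemma edge_alongE w i j l :
  edge_along w [:: i; j; l] = edge (nth ord0 w i) (nth ord0 w j) (nth ord0 w l).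
Proof. by congr insubd; apply/setP => x; rewrite !inE orbA. Qed.

Lemma perm_edge_along w s r : perm_eq s r -> edge_along w s = edge_along w r.
Proof.
move=> sr; congr insubd; apply/setP => x.
by rewrite !inE (perm_mem (perm_map _ sr)).
Qed.

Lemma edge_along_map w pi s : all (gtn (size pi)) s ->
  edge_along (map (nth ord0 w) pi) s = edge_along w (map (nth 0%N pi) s).
Proof.
move=> /allP s_pi; rewrite /edge_along -map_comp.
suff -> : map (nth ord0 (map (nth ord0 w) pi)) s =
    map (nth ord0 w \o nth 0%N pi) s by [].
by apply/eq_in_map => i /s_pi i_lt; rewrite /= (nth_map 0%N).
Qed.

Lemma edge_along_faces w s (S : {set 'I_6}) :
  uniq w -> size s = 3%N -> uniq s -> all (gtn (size w)) s ->
  edge_along w s \in faces S -> {in s, forall i, nth ord0 w i \in S}.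
Proof.
move=> w_uniq s3 s_uniq s_lt; rewrite inE val_insubd.
have -> : #|[set x in map (nth ord0 w) s]| == 3%N.
  by rewrite cardsE (card_uniqP _) ?uniq_map_nth ?size_map ?s3.
by move=> /subsetP sS i si; apply: sS; rewrite inE map_f.
Qed.

(* All the faces of [q] but the one opposite to its first vertex are in [conf].
   A relation of [q] then reduces [conf] to [conf'], which may contain the
   missing face, but no other face of [q]. *)
Definition apex_step (n : nat) (q : seq nat) (conf conf' : seq (seq nat)) :
    bool :=
  [&& uniq q, all (gtn n) q,
      all (fun i => has (perm_eq (rem_nth i q)) conf) [:: 1; 2; 3]%N &
      all (fun s => perm_eq s (behead q) ||
        [&& size s == 3%N, uniq s, all (gtn n) s, has (perm_eq s) conf &
            ~~ all (mem q) s]) conf'].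

Section Configurations.

Variables (R : zmodType) (F : colouring -> R).
Hypothesis F_balanced : balanced F.

Definition vanishing_conf (n : nat) (conf : seq (seq nat)) : Prop :=
  forall (w : seq 'I_6) (b : bool) (c : colouring), uniq w -> size w = n ->
    monochromatic b c (map (edge_along w) conf) -> F c = 0.

Lemma monochromatic_perm w b c conf s : has (perm_eq s) conf ->
  monochromatic b c (map (edge_along w) conf) -> c (edge_along w s) = b.
Proof.
by case/hasP=> r r_conf /(perm_edge_along w)-> /allP/(_ _ (map_f _ r_conf))/eqP.
Qed.

Definition conf_a_triples : seq (seq nat) :=
  [:: [:: 0; 1; 2]; [:: 0; 1; 3]; [:: 0; 2; 3]; [:: 1; 2; 3]]%N.

Lemma vanishing_conf_a : vanishing_conf 4 conf_a_triples.
Proof.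
move=> [|x [|y [|z [|t [|? ?]]]]] // b c w_uniq _.
rewrite [map _ _]/= !edge_alongE => /allP cb.
have tetra_balanced := F_balanced (card_set4 w_uniq).
apply: (exchange_balanced_monochromatic tetra_balanced (b := b)) => a.
by rewrite -mem_tetra // => /cb/eqP.
Qed.

Lemma apex_step_eq0 w b c p0 p1 p2 p3 conf conf' :
  uniq w -> apex_step (size w) [:: p0; p1; p2; p3] conf conf' ->
  monochromatic b c (map (edge_along w) conf) ->
  (forall d, monochromatic b d (map (edge_along w) conf') -> F d = 0) ->
  F c = 0.
Proof.
move=> w_uniq; set q := [:: p0; _; _; _].
case/and4P=> q_uniq q_lt /and4P[face1 face2 face3 _] /allP conf'_step c_mono F0.
pose S := [set nth ord0 w p0; nth ord0 w p1; nth ord0 w p2; nth ord0 w p3].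
have wq_uniq : uniq (map (nth ord0 w) q) by apply: uniq_map_nth.
have tetraE a : a \in faces S = (a \in [:: edge_along w [:: p0; p1; p2];
    edge_along w [:: p0; p1; p3]; edge_along w [:: p0; p2; p3];
    edge_along w [:: p1; p2; p3]]).
  by rewrite !edge_alongE -(mem_tetra a wq_uniq).
apply: (exchange_balanced_all_but_one (F_balanced (card_set4 wq_uniq))
  (b := b) (z := edge_along w (behead q))) => [a|d /agree_offP dc dz].
  rewrite tetraE !inE => /or4P[]/eqP-> //; rewrite ?eqxx // => _;
  exact: monochromatic_perm c_mono.
apply: F0; apply/allP => _ /mapP[s s_conf' ->].
have /orP[/(perm_edge_along w)->|] := conf'_step s s_conf'; first by rewrite dz.
case/and5P=> /eqP s3 s_uniq s_lt s_conf sq.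
rewrite dc; first by rewrite (monochromatic_perm s_conf c_mono).
apply: contra sq => /(edge_along_faces w_uniq s3 s_uniq s_lt) sS.
apply/allP => i si; have i_lt : (i < size w)%N := allP s_lt i si.
have : nth ord0 w i \in map (nth ord0 w) q.
  by have := sS i si; rewrite !inE !orbA.
case/mapP=> j jq /eqP; have j_lt : (j < size w)%N := allP q_lt j jq.
by rewrite nth_uniq // => /eqP->.
Qed.

Lemma vanishing_conf_step n conf p0 p1 p2 p3 pi conf' :
  vanishing_conf (size pi) conf' -> uniq pi -> all (gtn n) pi ->
  all (all (gtn (size pi))) conf' ->
  apex_step n [:: p0; p1; p2; p3] conf (map (map (nth 0%N pi)) conf') ->
  vanishing_conf n conf.
Proof.
move=> van pi_uniq pi_lt conf'_lt step w b c w_uniq w_size c_mono.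
rewrite -w_size in pi_lt step.
apply: (apex_step_eq0 w_uniq step c_mono) => d d_mono.
apply: (van (map (nth ord0 w) pi) b d); first exact: uniq_map_nth.
  by rewrite size_map.
suff -> : map (edge_along (map (nth ord0 w) pi)) conf' =
  map (edge_along w) (map (map (nth 0%N pi)) conf') by [].
rewrite -map_comp; apply/eq_in_map => s s_conf' /=.
by rewrite edge_along_map //; apply: (allP conf'_lt).
Qed.

Definition conf_b_triples : seq (seq nat) :=
  [:: [:: 0; 1; 2]; [:: 0; 1; 3]; [:: 0; 2; 3];
      [:: 1; 2; 4]; [:: 1; 3; 4]; [:: 2; 3; 4]]%N.

Definition conf_c_triples : seq (seq nat) :=
  [:: [:: 0; 1; 4]; [:: 0; 1; 5]; [:: 1; 2; 4]; [:: 0; 2; 4];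
      [:: 0; 3; 5]; [:: 1; 3; 5]; [:: 1; 2; 3]; [:: 0; 2; 3]]%N.

Definition conf_d_triples : seq (seq nat) :=
  [:: [:: 0; 1; 2]; [:: 0; 1; 3]; [:: 0; 2; 3]; [:: 0; 1; 4]; [:: 1; 3; 4];
      [:: 0; 1; 5]; [:: 0; 4; 5]; [:: 1; 2; 5]; [:: 2; 3; 5]; [:: 3; 4; 5]]%N.

Lemma vanishing_conf_b : vanishing_conf 5 conf_b_triples.
Proof.
by apply: (vanishing_conf_step (p0 := 0) (p1 := 1) (p2 := 2) (p3 := 3)
  (pi := [:: 1; 2; 3; 4]%N) vanishing_conf_a).
Qed.

Lemma vanishing_conf_c : vanishing_conf 6 conf_c_triples.
Proof.
by apply: (vanishing_conf_step (p0 := 4) (p1 := 0) (p2 := 1) (p3 := 2)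
  (pi := [:: 2; 0; 1; 3; 5]%N) vanishing_conf_b).
Qed.

Lemma vanishing_conf_d : vanishing_conf 6 conf_d_triples.
Proof.
by apply: (vanishing_conf_step (p0 := 0) (p1 := 1) (p2 := 2) (p3 := 3)
  (pi := [:: 1; 5; 4; 3; 0; 2]%N) vanishing_conf_c).
Qed.

Lemma balanced_has_conf (b : bool) (c : colouring) (H : {set hedge}) :
  (forall a, a \in H -> c a = b) -> has_conf H -> F c = 0.
Proof.
move=> Hb; have mono s : contains H s -> monochromatic b c s.
  by move/allP => Hs; apply/allP => a /Hs/Hb->.
case/or4P.
- case/existsP => x /existsP[y /existsP[z /existsP[t]]].
  case/andP=> w_uniq /mono c_mono.
  by apply: (vanishing_conf_a w_uniq erefl (b := b)); rewrite /= !edge_alongE.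
- case/existsP => x /existsP[y /existsP[z /existsP[t /existsP[u]]]].
  case/andP=> w_uniq /mono c_mono.
  by apply: (vanishing_conf_b w_uniq erefl (b := b)); rewrite /= !edge_alongE.
- case/existsP => x /existsP[y /existsP[z /existsP[t /existsP[u /existsP[v]]]]].
  case/andP=> w_uniq /mono c_mono.
  by apply: (vanishing_conf_c w_uniq erefl (b := b)); rewrite /= !edge_alongE.
case/existsP => x /existsP[y /existsP[z /existsP[t /existsP[u /existsP[v]]]]].
case/andP=> w_uniq /mono c_mono.
by apply: (vanishing_conf_d w_uniq erefl (b := b)); rewrite /= !edge_alongE.
Qed.

End Configurations.

(** * Partitions and the determinant *)

Definition hpart_colouring (P : hpart) : colouring :=
  [ffun a => a \in (val P).2].

Lemma mem_hpart1 (P : hpart) a : (a \in (val P).1) = (a \notin (val P).2).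
Proof.
have /and4P[/pred0P dP /eqP uP _ _] := valP P.
have /= := dP a; have := in_setT a; rewrite -uP inE.
by case: (a \in (val P).1); case: (a \in (val P).2).
Qed.

Lemma weight_hpart P : weight (hpart_colouring P) = 10%N.
Proof. by rewrite weight_set; have /and4P[_ _ _ /eqP] := valP P. Qed.

Lemma hpart_colouring_inj : injective hpart_colouring.
Proof.
move=> P Q /ffunP PQ; apply: val_inj.
have mem2 a : (a \in (val P).2) = (a \in (val Q).2).
  by have := PQ a; rewrite !ffunE.
by apply: injective_projections; apply/setP => a; rewrite ?mem_hpart1 mem2.
Qed.

Lemma hpart_colouring_surj c : weight c = 10%N ->
  exists P, hpart_colouring P = c.
Proof.
move=> wc; pose A := [set a | c a].
have cA : [ffun a => a \in A] = c by apply/ffunP => a; rewrite ffunE inE.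
have A10 : #|A| = 10%N by rewrite -weight_set cA.
have P_hpart : is_hpart (~: A, A).
  rewrite /is_hpart /= A10 -setI_eq0 setIC setICr setUC setUCr !eqxx andbT /=.
  by rewrite -(eqn_add2l #|A|) cardsC A10 card_hedge.
by exists (exist (fun Q => is_true (is_hpart Q)) _ P_hpart).
Qed.

Lemma big_hpart (R : nmodType) (C : pred colouring)
    (f : colouring -> R) :
  \sum_(P | C (hpart_colouring P)) f (hpart_colouring P) =
  \sum_(c | C c && (weight c == 10%N)) f c.
Proof.
rewrite (partition_big hpart_colouring
    (fun c => C c && (weight c == 10%N))) /=; last first.
  by move=> P ->; rewrite weight_hpart.
apply: eq_bigr => c /andP[Cc /eqP/hpart_colouring_surj[P Pc]].
rewrite (big_pred1 P) ?Pc // => Q /=; rewrite -Pc (inj_eq hpart_colouring_inj).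
by case: eqP => [->|_]; rewrite ?Pc ?Cc ?andbF.
Qed.

Lemma sum_Pair (R : nmodType) (f : colouring -> R) P x y z t :
  uniq [:: x; y; z; t] ->
  \sum_(K in Pair P x y z t) f (hpart_colouring K) =
  \sum_(d | exchange (faces [set x; y; z; t]) (hpart_colouring P) d) f d.
Proof.
move=> xyzt_uniq; pose B := faces [set x; y; z; t].
transitivity (\sum_(K | agree_off B (hpart_colouring P) (hpart_colouring K))
    f (hpart_colouring K)).
  apply: eq_bigl => K; rewrite inE; apply: eq_forallb => a.
  rewrite mem_tetra // !ffunE !mem_hpart1; congr (_ ==> _).
  by case: (a \in _); case: (a \in _).
by rewrite big_hpart /exchange weight_hpart.
Qed.

Definition P1_indices : seq nat :=
  [seq index [:: a.1.1.-1; a.1.2.-1; a.2.-1]%N triples | a <- P1_triples].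

Lemma P1_seqE : P1_seq = map (nth hedge0 hedges) P1_indices.
Proof.
rewrite /P1_seq /P1_indices -map_comp; apply/eq_in_map => a aP1.
have /allP/(_ a aP1)/andP[a6 a3] : all (fun a =>
    all (gtn 6) [:: a.1.1.-1; a.1.2.-1; a.2.-1] &&
    ([:: a.1.1.-1; a.1.2.-1; a.2.-1] \in triples)) P1_triples by vm_compute.
rewrite /vtx edge_inord // -[RHS]/(nth hedge0 hedges (index _ triples)).
by rewrite (nth_map [::]) ?index_mem // nth_index.
Qed.

Lemma P1_colouring :
  hpart_colouring P1 =
  colouring_of hedges [seq i \notin P1_indices | i <- iota 0 20].
Proof.
apply/ffunP => a; rewrite !ffunE inE inE P1_seqE.
have a_lt := index_hedges_lt a.
rewrite (nth_map 0%N) ?size_iota // nth_iota // add0n; congr negb.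
apply/mapP/idP => [[i iP1 ->]|aP1]; last first.
  by exists (index a hedges); rewrite ?nth_index ?mem_hedges.
have i_lt : (i < size hedges)%N.
  by rewrite size_hedges; move: i iP1; apply/allP; vm_compute.
by rewrite index_uniq ?uniq_hedges.
Qed.

Lemma eps_det_P1 : eps_det (hpart_colouring P1) = 1.
Proof. by rewrite P1_colouring eps_det_colouring_of; vm_compute. Qed.

Lemma eps_det_is_epsS3 : is_epsS3 [ffun P => eps_det (hpart_colouring P)].
Proof.
split=> [P|P x y z t xy yz zt|]; last by rewrite ffunE eps_det_P1.
  by rewrite ffunE; apply: eps_det_value.
have xyzt_uniq := lt4_uniq xy yz zt.
rewrite -[RHS](eps_det_balanced (card_set4 xyzt_uniq) (hpart_colouring P)).
by rewrite -sum_Pair //; apply: eq_bigr => K _; rewrite ffunE.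
Qed.

Definition hpart_extension (R : nmodType) (f : hpart -> R) (c : colouring) :
    R :=
  \sum_(P | hpart_colouring P == c) f P.

Lemma hpart_extensionE (R : nmodType) (f : hpart -> R) P :
  hpart_extension f (hpart_colouring P) = f P.
Proof.
rewrite /hpart_extension (big_pred1 P) // => K.
by rewrite (inj_eq hpart_colouring_inj).
Qed.

Lemma balanced_hpart_extension (R : zmodType) (f : hpart -> R) :
  (forall (P : hpart) (x y z t : 'I_6), (x < y)%N -> (y < z)%N -> (z < t)%N ->
     \sum_(K in Pair P x y z t) f K = 0) ->
  balanced (hpart_extension f).
Proof.
move=> sum0 S S4 c; have [wc|wc] := eqVneq (weight c) 10%N; last first.
  rewrite big1 // => d /exchangeP[_ wd].
  rewrite /hpart_extension big_pred0 // => K.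
  by apply: contraNF wc => /eqP Kd; rewrite -wd -Kd weight_hpart.
have [Q <-] := hpart_colouring_surj wc.
have [x [y [z [t [[xy yz zt] ->]]]]] := set4P S4.
rewrite -sum_Pair ?lt4_uniq // -[RHS](sum0 Q x y z t xy yz zt).
by apply: eq_bigr => K _; rewrite hpart_extensionE.
Qed.

Lemma epsS3E P : epsS3 P = eps_det (hpart_colouring P).
Proof.
have [_ sum0 eps1] : is_epsS3 epsS3.
  exact: classical_sets.xgetPex (ex_intro _ _ eps_det_is_epsS3).
have scale := balanced_proportional (balanced_hpart_extension sum0).
have root1 : hpart_extension epsS3 root_colouring = 1.
  have := scale (hpart_colouring P1).
  by rewrite hpart_extensionE eps1 eps_det_P1 mulr1.
by rewrite -(hpart_extensionE epsS3) scale root1 mul1r intz.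
Qed.

Lemma eps_det_trivial P : ~~ nontrivial P -> eps_det (hpart_colouring P) = 0.
Proof.
case/nandP => /negPn conf.
  apply: (balanced_has_conf eps_det_balanced (b := false) _ conf) => a.
  by rewrite ffunE mem_hpart1 => /negbTE.
apply: (balanced_has_conf eps_det_balanced (b := true) _ conf) => a.
by rewrite ffunE.
Qed.

Lemma monomialE (k : fieldType) (V : vectType k) (e : 2.-tuple V) P v :
  monomial e P v = \prod_a coord e (bool_ord (hpart_colouring P a)) (v a).
Proof.
rewrite /monomial (bigID (fun a => a \in (val P).1) predT) /=.
congr (_ * _); apply: eq_big => a; rewrite ?mem_hpart1 ?negbK // ffunE.
  by move/negPf ->.
by move=> ->.
Qed.

Lemma detS3_formE (k : fieldType) (V : vectType k) (e : 2.-tuple V) :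
  basis_of fullv e -> detS3_form e =1 bracket_det e.
Proof.
move=> e_basis v.
pose term c : k := (eps_det c)%:~R * \prod_a coord e (bool_ord (c a)) (v a).
transitivity (\sum_(P : hpart) term (hpart_colouring P)).
  rewrite /detS3_form [RHS](bigID nontrivial) /= [X in _ = _ + X]big1 ?addr0.
    by apply: eq_bigr => P _; rewrite epsS3E monomialE.
  by move=> P /eps_det_trivial eps0; rewrite /term eps0 mul0r.
rewrite (big_hpart predT term) big_mkcond.
rewrite (multilinear_basis_sum e_basis (bracket_det_multilinear e)).
apply: eq_bigr => c _; rewrite bracket_det_basis_family // /term.
have [->|/eps_det_weight->] := eqVneq (eps_det c) 0.
  by rewrite scaler0 mul0r if_same.
by rewrite eqxx; apply: mulrC.
Qed.

Section TensorPowerForms.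

Variables (k : fieldType) (V : vectType k) (e : 2.-tuple V).
Hypothesis e_basis : basis_of fullv e.
Variables (T : lmodType k) (tens : {ffun hedge -> V} -> T).
Hypothesis T_tensor : is_tensor_power tens.
Variable D : {linear T -> k^o}.
Hypothesis DE : forall v, D (tens v) = bracket_det e v.

Lemma bracket_form_neq0 : exists t, D t <> 0.
Proof.
exists (tens (basis_family e root_colouring)).
by rewrite DE bracket_det_basis_family // eps_det_root; apply/eqP/oner_neq0.
Qed.

Lemma bracket_form_vanishes : vanishes_on_degenerate tens D.
Proof. by move=> v v_deg; rewrite DE bracket_det_degenerate. Qed.

Lemma bracket_form_unique (s : seq k) (f : {linear T -> k^o}) :
  uniq s -> (20 < size s)%N -> vanishes_on_degenerate tens f ->
  exists c : k, forall t, f t = c * D t.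
Proof.
move=> s_uniq s_large f_van; exists (f (tens (basis_family e root_colouring))).
set a := f _; have fL := tensor_linear_multilinear T_tensor f.
have f_balanced := multilinear_balanced e_basis s_uniq s_large fL f_van.
apply: (tensor_linear_ext T_tensor (g := (a \*: D)%R)) => v /=.
rewrite DE !(multilinear_basis_sum e_basis fL).
rewrite (multilinear_basis_sum e_basis (bracket_det_multilinear e)) scaler_sumr.
apply: eq_bigr => c _; rewrite bracket_det_basis_family //.
by rewrite (balanced_proportional f_balanced); apply: mulrCA.
Qed.

End TensorPowerForms.

Theorem theorem4p12
  (k : fieldType)
  (k_infinite : ~ cardinality.finite_set (@classical_sets.setT k))
  (k_char2 : 2%N \notin [pchar k]) (k_char3 : 3%N \notin [pchar k])
  (V : vectType k) (e : 2.-tuple V) (e_basis : basis_of fullv e)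
  (T : lmodType k) (tens : {ffun hedge -> V} -> T)
  (T_tensor : is_tensor_power tens)
  (detS3 : {linear T -> k^o})
  (detS3E : forall v : {ffun hedge -> V}, detS3 (tens v) = detS3_form e v) :
  [/\ exists t, detS3 t <> 0,
      vanishes_on_degenerate tens detS3
    & forall f : {linear T -> k^o}, vanishes_on_degenerate tens f ->
        exists c : k, forall t, f t = c * detS3 t] /\
  (forall (L : lmodType k) (proj : {linear T -> L}),
     is_quotient (ES3 tens) proj ->
     exists D : {linear L -> k^o},
       [/\ forall t, D (proj t) = detS3 t,
           exists q, D q <> 0
         & forall f : {linear L -> k^o}, exists c : k, forall q, f q = c * D q]).
Proof.
have detE v : detS3 (tens v) = bracket_det e v by rewrite detS3E detS3_formE.
have [s s_uniq s_size] := infinite_uniq_seq k_infinite 21.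
have s_large : (20 < size s)%N by rewrite s_size.
have nonzero := bracket_form_neq0 e_basis detE.
have vanishes := bracket_form_vanishes detE.
have unique f :=
  bracket_form_unique e_basis T_tensor detE (f := f) s_uniq s_large.
split=> // L proj quot; apply: (quotient_unique_form quot nonzero).
  by move=> _ [v v_deg ->]; apply: vanishes.
by move=> f f0; apply: unique => v v_deg; apply: f0; exists v.
Qed.
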